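(* Consider the difference operators $$H(s,n)=\sqrt{\Theta(s-1)\sigma(s)}\frac{1}{\nabla x(s)}E^-+\sqrt{\Theta(s)\sigma(s+1)}\frac{1}{\Delta x(s)}E^+-\left(\frac{\Theta(s)}{\Delta x(s)}+\frac{\sigma(s)}{\nabla x(s)}-\lambda_n\Delta x(s-\tfrac12)\right)I,$$ (so that $H(s,n)\varphi_n(s)=0$ is the hypergeometric-type difference equation for the orthonormal functions $\varphi_n$) and $$L^+(s,n)=u(s,n)I+\sqrt{\Theta(s-1)\sigma(s)}\frac1{\nabla x(s)}E^-,\qquad L^-(s,n)=v(s,n)I+\sqrt{\Theta(s)\sigma(s+1)}\frac1{\Delta x(s)}E^+,$$ where $$u(s,n)=\frac{\lambda_n}{[n]_q}\frac{\tau_n(s)}{\tau'_n}-\frac{\sigma(s)}{\nabla x(s)},\qquad v(s,n)=-\frac{\lambda_n}{[n]_q}\frac{\tau_n(s)}{\tau'_n}+\lambda_n\Delta x(s-\tfrac12)+\frac{\lambda_{2n}}{[2n]_q}(x(s)-\beta_n)-\frac{\Theta(s)}{\Delta x(s)}.$$ Then, for every $n\ge0$ (such that $P_{n+1}$ belongs to the orthogonal family), $H$ admits the factorizations $$u(s+1,n)H(s,n)=L^-(s,n+1)L^+(s,n)-h^{\mp}(n)I$$ and $$u(s,n)H(s,n+1)=L^+(s,n)L^-(s,n+1)-h^{\mp}(n)I,$$ where $h^{\mp}(n)$ is the constant, independent of $s$, $$h^{\mp}(n)=\frac{\lambda_{2n}}{[2n]_q}\frac{\lambda_{2n+2}}{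[2n+2]_q}\alpha_n\gamma_{n+1}.$$
   Context: Notation. $q>0$, $q\ne1$; $[m]_q=\frac{q^{m/2}-q^{-m/2}}{q^{1/2}-q^{-1/2}}$, $\alpha_q(m)=\frac{q^{m/2}+q^{-m/2}}2$. $\Delta f(s)=f(s+1)-f(s)$, $\nabla f(s)=f(s)-f(s-1)$, $E^{\pm}f(s)=f(s\pm1)$, $I$ is the identity; products of operators are compositions, with $E^\pm$ acting on everything to their right; $\Delta x(s-\frac12)=x(s+\frac12)-x(s-\frac12)$. The lattice is $x(s)=c_1q^s+c_2q^{-s}+c_3$ with constants $c_1,c_2$ not both zero, and $x_k(s)=x(s+\frac k2)$. Difference equation. Let $\tilde\sigma(s)=\frac{\tilde\sigma''}{2}x(s)^2+\tilde\sigma'(0)x(s)+\tilde\sigma(0)$ and $\tau(s)=\tilde\tau' x(s)+\tilde\tau(0)$ with constant coefficients, $\sigma(s)=\tilde\sigma(s)-\frac12\tau(s)\Delta x(s-\frac12)$, $\Theta(s)=\sigma(s)+\tau(s)\Delta x(s-\frac12)$. The hypergeometric-type equation is $$\sigma(s)\frac{\Delta}{\Delta x(s-\frac12)}\left[\frac{\nabla y(s)}{\nabla x(s)}\right]+\tau(s)\frac{\Delta y(s)}{\Delta x(s)}+\lambda y(s)=0 .$$ Put $\lambda_n=-[n]_q\{\alpha_q(n-1)\tilde\tau'+[n-1]_q\frac{\tilde\sigma''}2\}$; for every $m\ge0$, $\frac{\lambda_m}{[m]_q}$ means $-\{\alpha_q(m-1)\tilde\tau'+[m-1]_q\frac{\tilde\sigma''}2\}$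 (also for $m=0$). Let $\tau_n(s)=\frac{\sigma(s+n)-\sigma(s)+\tau(s+n)\Delta x(s+n-\frac12)}{\Delta x_{n-1}(s)}$, which is of the form $\tau_n(s)=\tau_n'x_n(s)+\tau_n(0)$ with $$\tau_n'=[2n]_q\frac{\tilde\sigma''}2+\alpha_q(2n)\tilde\tau',\quad \tau_n(0)=\frac{c_3\tilde\sigma''}2(2[n]_q-[2n]_q)+\tilde\sigma'(0)[n]_q+c_3\tilde\tau'(\alpha_q(n)-\alpha_q(2n))+\tilde\tau(0)\alpha_q(n).$$ Polynomials. $\rho$ satisfies the Pearson equation $\Delta[\sigma(s)\rho(s)]=\tau(s)\rho(s)\Delta x(s-\frac12)$, i.e. $\sigma(s+1)\rho(s+1)=\Theta(s)\rho(s)$. $P_n(x(s))_q$ is the polynomial solution, of degree $n$ in $x(s)$ with leading coefficient $a_n\ne0$, of the equation with $\lambda=\lambda_n$, given by $P_n(x(s))_q=\frac{B_n}{\rho(s)}\frac{\nabla}{\nabla x_1(s)}\cdots\frac{\nabla}{\nabla x_n(s)}\rho_n(s)$, $\rho_n(s)=\rho(s+n)\prod_{k=1}^n\sigma(s+k)$, with constants $B_n\neq0$. The polynomials are assumed orthogonal with squared norms $d_n^2\ne0$, either in the discrete sense $$\sum_{s=a}^{b-1}P_n(x(s))_qP_m(x(s))_q\rho(s)\Delta x(s-\tfrac12)=\delta_{nm}d_n^2$$ (under the boundary conditions $\sigma(a)=0$ and $\sigma(s)\rho(s)x^k(s-\frac12)|_{s=a,b}=0$ for all $k\ge0$; if $b-a=N$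 is finite the orthogonal family is $P_0,\dots,P_{N-1}$), or in the continuous sense, with $\sum_{s=a}^{b-1}(\cdot)$ replaced by $\int_\Gamma(\cdot)\,ds$ for a contour $\Gamma$ such that $\int_\Gamma\Delta[\rho(z)\sigma(z)x^k(z-\frac12)]dz=0$ for all $k\ge0$. Consequently they satisfy the three-term recurrence relation $xP_n=\alpha_nP_{n+1}+\beta_nP_n+\gamma_nP_{n-1}$ (with $P_{-1}=0$), where $$\alpha_n=\frac{a_n}{a_{n+1}},\quad \gamma_n=\frac{a_{n-1}}{a_n}\frac{d_n^2}{d_{n-1}^2},\quad \beta_n=\frac{[n]_q\tau_{n-1}(0)}{\tau'_{n-1}}-\frac{[n+1]_q\tau_n(0)}{\tau'_n}+c_3([n]_q+1-[n+1]_q)$$ (first term of $\beta_n$ equal to $0$ for $n=0$). The orthonormal functions are $\varphi_n(s)=\sqrt{\rho(s)/d_n^2}\,P_n(x(s))_q$. All denominators occurring (values of $\Delta x(s)$, $\nabla x(s)$, and $\tau_n'$) are assumed nonzero. Square roots: $\sqrt{\Theta(s)\sigma(s+1)}$ denotes the branch $\Theta(s)\sqrt{\rho(s)}/\sqrt{\rho(s+1)}$ (its square is $\Theta(s)\sigma(s+1)$ by the Pearson equation), and $\sqrt{\Theta(s-1)\sigma(s)}$ is the same function at $s-1$. The operator identities are understood as identities of operators acting on functions of $s$, with the coefficients regarded as functions of the variable $s$. *)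

(* Defs.v *)
From Stdlib Require Import Reals List PeanoNat.
From Coquelicot Require Import Coquelicot.

Local Open Scope C_scope.

(* q^s for q > 0 and complex s, with the real logarithm of q. *)
Definition qpow (q : R) (s : C) : C :=
  ((Rpower q (Re s) * cos (Im s * ln q))%R,
   (Rpower q (Re s) * sin (Im s * ln q))%R).

(* [m]_q and alpha_q(m); m is real so that m = n - 1 is not truncated. *)
Definition qnum (q m : R) : R :=
  ((Rpower q (m / 2) - Rpower q (- m / 2)) /
   (Rpower q (1 / 2) - Rpower q (- (1 / 2))))%R.

Definition qalpha (q m : R) : R :=
  ((Rpower q (m / 2) + Rpower q (- m / 2)) / 2)%R.

Definition half : C := RtoC (1 / 2).

Definition Delta (f : C -> C) (s : C) : C := f (s + 1) - f s.
Definition Nabla (f : C -> C) (s : C) : C := f s - f (s - 1).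

Definition operator := (C -> C) -> (C -> C).

Definition Iop : operator := fun f => f.
Definition Eplus : operator := fun f s => f (s + 1).
Definition Eminus : operator := fun f s => f (s - 1).
Definition op_add (A B : operator) : operator := fun f s => A f s + B f s.
Definition op_sub (A B : operator) : operator := fun f s => A f s - B f s.
Definition op_mul (c : C -> C) (A : operator) : operator :=
  fun f s => c s * A f s.
Definition op_comp (A B : operator) : operator := fun f => A (B f).

Definition op_eq_on (reg : C -> Prop) (A B : operator) : Prop :=
  forall (f : C -> C) (s : C), reg s -> A f s = B f s.

(* stilde2, stilde1, stilde0 are sigma~'', sigma~'(0), sigma~(0);
   ttilde1, ttilde0 are tau~', tau~(0). *)
Record equation := Equation {
  q : R;
  c1 : C; c2 : C; c3 : C;
  stilde2 : C; stilde1 : C; stilde0 : C;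
  ttilde1 : C; ttilde0 : C
}.

Definition x (E : equation) (s : C) : C :=
  c1 E * qpow (q E) s + c2 E * qpow (q E) (- s) + c3 E.

Definition xk (E : equation) (k : R) (s : C) : C := x E (s + RtoC (k / 2)).

Definition Dxmid (E : equation) (s : C) : C := Delta (x E) (s - half).

Definition stilde (E : equation) (s : C) : C :=
  stilde2 E / 2 * (x E s) ^ 2 + stilde1 E * x E s + stilde0 E.

Definition tau (E : equation) (s : C) : C := ttilde1 E * x E s + ttilde0 E.

Definition sigma (E : equation) (s : C) : C :=
  stilde E s - half * tau E s * Dxmid E s.

Definition Theta (E : equation) (s : C) : C :=
  sigma E s + tau E s * Dxmid E s.

(* lambda_m / [m]_q, extended to m = 0 *)
Definition lambda_over (E : equation) (m : nat) : C :=
  - (RtoC (qalpha (q E) (INR m - 1)) * ttilde1 E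
     + RtoC (qnum (q E) (INR m - 1)) * (stilde2 E / 2)).

Definition lambda (E : equation) (n : nat) : C :=
  RtoC (qnum (q E) (INR n)) * lambda_over E n.

(* y solves the equation with spectral parameter lam at the point s *)
Definition solves_at (E : equation) (lam : C) (y : C -> C) (s : C) : Prop :=
  sigma E s * (Delta (fun t => Nabla y t / Nabla (x E) t) s / Dxmid E s)
  + tau E s * (Delta y s / Delta (x E) s) + lam * y s = 0.

Definition tau_n (E : equation) (n : nat) (s : C) : C :=
  let sn := s + RtoC (INR n) in
  (sigma E sn - sigma E s + tau E sn * Dxmid E sn)
  / Delta (xk E (INR n - 1)) s.

(* tau_n' and tau_n(0): the coefficients in tau_n = tau_n' x_n + tau_n(0) *)
Definition tau_n' (E : equation) (n : nat) : C :=
  RtoC (qnum (q E) (2 * INR n)) * (stilde2 E / 2)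
  + RtoC (qalpha (q E) (2 * INR n)) * ttilde1 E.

Definition tau_n0 (E : equation) (n : nat) : C :=
  let qn := qnum (q E) (INR n) in
  let q2n := qnum (q E) (2 * INR n) in
  let an := qalpha (q E) (INR n) in
  let a2n := qalpha (q E) (2 * INR n) in
  c3 E * stilde2 E / 2 * RtoC (2 * qn - q2n) + stilde1 E * RtoC qn
  + c3 E * ttilde1 E * RtoC (an - a2n) + ttilde0 E * RtoC an.

Definition beta (E : equation) (n : nat) : C :=
  let qn := qnum (q E) (INR n) in
  let qn1 := qnum (q E) (INR n + 1) in
  match n with
  | O => 0
  | S m => RtoC qn * tau_n0 E m / tau_n' E m
  end
  - RtoC qn1 * tau_n0 E n / tau_n' E n
  + c3 E * RtoC (qn + 1 - qn1).

(* A parametrized contour; [cbreaks] are the corners. *)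
Record contour := Contour {
  cpath : R -> C;
  cspeed : R -> C;
  clo : Rbar;
  chi : Rbar;
  cbreaks : list R
}.

Definition in_param (G : contour) (t : R) : Prop :=
  Rbar_lt (clo G) t /\ Rbar_lt t (chi G).

Definition contour_ok (G : contour) : Prop :=
  Rbar_lt (clo G) (chi G) /\
  (forall t, in_param G t ->
     continuous (U := C_UniformSpace) (cpath G) t) /\
  (forall t, in_param G t -> ~ In t (cbreaks G) ->
     is_derive (K := R_AbsRing) (V := C_R_NormedModule)
       (cpath G) t (cspeed G t) /\
     continuous (U := C_UniformSpace) (cspeed G) t).

Definition from_above (l : Rbar) : (R -> Prop) -> Prop :=
  match l with Finite r => at_right r | _ => Rbar_locally l end.
Definition from_below (l : Rbar) : (R -> Prop) -> Prop :=
  match l with Finite r => at_left r | _ => Rbar_locally l end.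

(* The (possibly improper) integral of g(z) dz along G equals l. *)
Definition contour_int (G : contour) (g : C -> C) (l : C) : Prop :=
  let F t := g (cpath G t) * cspeed G t in
  is_RInt_gen (V := R_NormedModule) (fun t => Re (F t))
    (from_above (clo G)) (from_below (chi G)) (Re l) /\
  is_RInt_gen (V := R_NormedModule) (fun t => Im (F t))
    (from_above (clo G)) (from_below (chi G)) (Im l).

(* [Finite_sum a N] is s = a, ..., b - 1 with b = a + N; [Infinite_sum a] is
   the case b = +oo. *)
Inductive support :=
  | Finite_sum (a : C) (N : nat)
  | Infinite_sum (a : C)
  | Contour_int (G : contour).

Definition in_family (Sp : support) (n : nat) : Prop :=
  match Sp with Finite_sum _ N => (n < N)%nat | _ => True end.

Definition node (a : C) (j : nat) : C := a + RtoC (INR j).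

(* "sum (or integral) of g = l"; a Finite_sum with N = 0 has no polynomials in
   its family, so the value given to that empty sum is irrelevant. *)
Definition total (Sp : support) (g : C -> C) (l : C) : Prop :=
  match Sp with
  | Finite_sum a N =>
      sum_n (G := C_AbelianMonoid) (fun j => g (node a j)) (pred N) = l
  | Infinite_sum a =>
      is_series (V := C_NormedModule) (fun j => g (node a j)) l
  | Contour_int G => contour_int G g l
  end.

(* dom is the set on which the weight rho is defined. *)
Definition support_in (Sp : support) (dom : C -> Prop) : Prop :=
  match Sp with
  | Finite_sum a N => forall j, (j <= N)%nat -> dom (node a j)
  | Infinite_sum a => forall j, dom (node a j)
  | Contour_int G =>
      contour_ok G /\
      forall t, in_param G t -> dom (cpath G t) /\ dom (cpath G t + 1)
  end.

Definition boundary (E : equation) (Sp : support) (rho : C -> C) : Prop :=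
  let w k s := sigma E s * rho s * (x E (s - half)) ^ k in
  match Sp with
  | Finite_sum a N =>
      sigma E a = 0 /\ forall k : nat, w k a = 0 /\ w k (node a N) = 0
  | Infinite_sum a =>
      sigma E a = 0 /\ forall k : nat, w k a = 0 /\
      filterlim (fun j => w k (node a j)) eventually
        (locally (T := C_UniformSpace) (RtoC 0))
  | Contour_int G => forall k : nat, contour_int G (Delta (w k)) 0
  end.

(* sqrho is a branch of sqrt(rho), coef n k the coefficient of x^k in P_n,
   and dnorm n = d_n, a square root of the squared norm d_n^2. *)
Record system := System {
  dom : C -> Prop;
  rho : C -> C;
  sqrho : C -> C;
  coef : nat -> nat -> C;
  rodB : nat -> C;
  dnorm : nat -> C;
  supp : support
}.

Definition P (W : system) (n : nat) (z : C) : C :=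
  sum_n (G := C_AbelianMonoid) (fun k => coef W n k * z ^ k) n.

Definition lead (W : system) (n : nat) : C := coef W n n.

Definition Px (E : equation) (W : system) (n : nat) (s : C) : C :=
  P W n (x E s).

Fixpoint sigma_prod (E : equation) (n : nat) (s : C) : C :=
  match n with
  | O => 1
  | S m => sigma_prod E m s * sigma E (s + RtoC (INR n))
  end.

Definition rho_n (E : equation) (W : system) (n : nat) (s : C) : C :=
  rho W (s + RtoC (INR n)) * sigma_prod E n s.

(* (nabla / nabla x_1(s)) ... (nabla / nabla x_n(s)) g *)
Fixpoint nabla_iter (E : equation) (n : nat) (g : C -> C) : C -> C :=
  match n with
  | O => g
  | S m => nabla_iter E m (fun s => Nabla g s / Nabla (xk E (INR n)) s)
  end.

(* Every quantity in the Rodrigues formula for P_n is defined at s. *)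
Definition rodrigues_regular (E : equation) (W : system) (n : nat) (s : C)
  : Prop :=
  (forall j, (j <= n)%nat -> dom W (s + RtoC (INR j))) /\
  rho W s <> 0 /\
  (forall k j, (1 <= k <= n)%nat -> (j < k)%nat ->
     Nabla (xk E (INR k)) (s - RtoC (INR j)) <> 0).

Record standing (E : equation) (W : system) : Prop := Standing {
  q_pos : (0 < q E)%R;
  q_neq1 : q E <> 1%R;
  lattice_nonconstant : c1 E <> 0 \/ c2 E <> 0;
  tau_n'_neq0 : forall n, in_family (supp W) n -> tau_n' E n <> 0;
  pearson : forall s, dom W s -> dom W (s + 1) ->
    Delta (fun t => sigma E t * rho W t) s = tau E s * rho W s * Dxmid E s;
  sqrhoE : forall s, dom W s -> (sqrho W s) ^ 2 = rho W s;
  lead_neq0 : forall n, in_family (supp W) n -> lead W n <> 0;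
  P_solves : forall n, in_family (supp W) n -> forall s,
    Delta (x E) s <> 0 -> Nabla (x E) s <> 0 -> Dxmid E s <> 0 ->
    solves_at E (lambda E n) (Px E W n) s;
  rodB_neq0 : forall n, in_family (supp W) n -> rodB W n <> 0;
  rodrigues : forall n, in_family (supp W) n -> forall s,
    rodrigues_regular E W n s ->
    Px E W n s = rodB W n / rho W s * nabla_iter E n (rho_n E W n) s;
  supp_dom : support_in (supp W) (dom W);
  supp_boundary : boundary E (supp W) (rho W);
  dnorm_neq0 : forall n, in_family (supp W) n -> dnorm W n <> 0;
  P_orthogonal : forall n m,
    in_family (supp W) n -> in_family (supp W) m ->
    total (supp W)
      (fun s => Px E W n s * Px E W m s * rho W s * Dxmid E s)
      (if Nat.eqb n m then (dnorm W n) ^ 2 else 0)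
}.

Definition phi (E : equation) (W : system) (n : nat) (s : C) : C :=
  sqrho W s / dnorm W n * Px E W n s.

(* alpha_n, and gamma_(n+1) *)
Definition alpha (W : system) (n : nat) : C := lead W n / lead W (S n).

Definition gammaS (W : system) (n : nat) : C :=
  lead W n / lead W (S n) * ((dnorm W (S n)) ^ 2 / (dnorm W n) ^ 2).

(* the chosen branch of sqrt (Theta(s) sigma(s+1)) *)
Definition root (E : equation) (W : system) (s : C) : C :=
  Theta E s * sqrho W s / sqrho W (s + 1).

(* If Theta(s) = 0 (e.g. at s = b - 1) the branch has the value 0 required by
   root^2 = Theta(s) sigma(s+1), also when rho(s+1) = 0. *)
Definition root_defined (E : equation) (W : system) (s : C) : Prop :=
  dom W s /\ dom W (s + 1) /\ (rho W (s + 1) <> 0 \/ Theta E s = 0).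

Definition Hop (E : equation) (W : system) (n : nat) : operator :=
  op_sub
    (op_add
       (op_mul (fun s => root E W (s - 1) * (1 / Nabla (x E) s)) Eminus)
       (op_mul (fun s => root E W s * (1 / Delta (x E) s)) Eplus))
    (op_mul (fun s => Theta E s / Delta (x E) s + sigma E s / Nabla (x E) s
                      - lambda E n * Dxmid E s) Iop).

Definition u (E : equation) (s : C) (n : nat) : C :=
  lambda_over E n * (tau_n E n s / tau_n' E n) - sigma E s / Nabla (x E) s.

Definition v (E : equation) (s : C) (n : nat) : C :=
  - lambda_over E n * (tau_n E n s / tau_n' E n) + lambda E n * Dxmid E s
  + lambda_over E (2 * n) * (x E s - beta E n) - Theta E s / Delta (x E) s.

Definition Lplus (E : equation) (W : system) (n : nat) : operator :=
  op_add (op_mul (fun s => u E s n) Iop)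
    (op_mul (fun s => root E W (s - 1) * (1 / Nabla (x E) s)) Eminus).

Definition Lminus (E : equation) (W : system) (n : nat) : operator :=
  op_add (op_mul (fun s => v E s n) Iop)
    (op_mul (fun s => root E W s * (1 / Delta (x E) s)) Eplus).

Definition hmp (E : equation) (W : system) (n : nat) : C :=
  lambda_over E (2 * n) * lambda_over E (2 * n + 2) * alpha W n * gammaS W n.

Definition H_regular (E : equation) (W : system) (s : C) : Prop :=
  Delta (x E) s <> 0 /\ Nabla (x E) s <> 0 /\
  root_defined E W s /\ root_defined E W (s - 1).

Definition tau_regular (E : equation) (n : nat) (s : C) : Prop :=
  Delta (xk E (INR n - 1)) s <> 0.

(* for u(s+1,n) H(s,n) and L^-(s,n+1) L^+(s,n) *)
Definition regular_mp (E : equation) (W : system) (n : nat) (s : C) : Prop :=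
  H_regular E W s /\
  tau_regular E n s /\ tau_regular E n (s + 1) /\ tau_regular E (S n) s.

(* for u(s,n) H(s,n+1) and L^+(s,n) L^-(s,n+1) *)
Definition regular_pm (E : equation) (W : system) (n : nat) (s : C) : Prop :=
  H_regular E W s /\
  tau_regular E n s /\ tau_regular E (S n) s /\ tau_regular E (S n) (s - 1).

(* Main.v *)
(* The two factorizations reduce to the identity v(s,n+1) = u(s+1,n) and to the s-independence of the
   coefficient of I, which are rational identities in q^s and q^(n/2); the second one also gives the
   constant explicitly, as a rational function of the coefficients of the equation.

   It remains to express that constant by the norms. On polynomials in z = x - c3 the difference
   operator D with D P_n = - lambda_n P_n satisfies z^2 D - (q + 1/q) z D z + D z^2 = K D + R, with K
   constant and R a quadratic polynomial. The Pearson equation and the boundary conditions make D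
   selfadjoint, so the diagonal matrix element of this relation at P_n is a relation between
   alpha_(n-1) gamma_n, alpha_n gamma_(n+1) and beta_n. Multiplied by lambda_(2n) / [2n]_q it says that
   h(n) - h(n-1) is the corresponding difference of the explicit constants, also when some
   lambda_(2n) vanishes and the eigenvalues lambda_n are not distinct. *)

(* [standing] does not contain the three-term recurrence, so it has to be derived. Since eigenvalues
   may coincide, P_n is not determined by its eigenvalue. What is available is lambda_n -
   lambda_(n+1) = tau_n' <> 0: it fixes the second coefficient of P_(n+1), hence beta_n. The
   products alpha_n gamma_(n+1) contain norms, which only orthogonality can reach.

   The diagonal element of z D z is the pairing of z P_n with D (z P_n). The recurrence is therefore
   needed at n only, and P_(n+2), which may lie outside a finite family, never occurs. All pairings
   that enter are products of two family members, whose totals are known to exist, or totals of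
   exact differences.

   Lattice points where Delta x, nabla x or [Dxmid] vanishes may belong to the support. Identities
   between polynomials are therefore checked at the remaining points, which give infinitely many
   lattice values, and so hold everywhere. *)
Require Import Defs.
From Stdlib Require Import Reals Lra Lia List Classical FunctionalExtensionality.
From Coquelicot Require Import Coquelicot.
(* [Reals] also exports a [c1]. *)
Import Defs.
Local Open Scope C_scope.

(* Up to [ring], the nonvanishing conditions left by [field] are hypotheses. *)
Ltac nonzero :=
  repeat split; auto;
  try match goal with
  | H : ?b <> RtoC 0 |- ?a <> RtoC 0 =>
      let Z := fresh in
      intros Z; apply H; rewrite <- Z; ring
  end.

(** * Complex powers of q *)

Lemma qpow_add (q : R) (s t : C) : qpow q (s + t) = qpow q s * qpow q t.
Proof.
unfold qpow; destruct s as [s1 s2], t as [t1 t2].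
apply injective_projections; simpl;
  rewrite Rpower_plus, ?Rmult_plus_distr_r, ?cos_plus, ?sin_plus; ring.
Qed.

Lemma qpow_RtoC (q r : R) : qpow q (RtoC r) = RtoC (Rpower q r).
Proof.
unfold qpow, RtoC; simpl.
now rewrite Rmult_0_l, cos_0, sin_0, Rmult_1_r, Rmult_0_r.
Qed.

Lemma qpow_opp_r (q : R) (s : C) : qpow q s * qpow q (- s) = 1.
Proof.
rewrite <- qpow_add; replace (s + - s) with (RtoC 0) by ring.
rewrite qpow_RtoC; unfold Rpower; now rewrite Rmult_0_l, exp_0.
Qed.

Lemma qpow_neq0 (q : R) (s : C) : qpow q s <> 0.
Proof.
intros H; generalize (qpow_opp_r q s); rewrite H, Cmult_0_l.
intros H'; apply (f_equal Re) in H'; simpl in H'; lra.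
Qed.

Lemma qpow_opp (q : R) (s : C) : qpow q (- s) = / qpow q s.
Proof.
assert (H := qpow_neq0 q s).
replace (qpow q (- s)) with (qpow q s * qpow q (- s) / qpow q s) by (field; nonzero).
rewrite qpow_opp_r; field; nonzero.
Qed.

Lemma RtoC_neq0 (r : R) : r <> 0%R -> RtoC r <> 0.
Proof. intros H H'; apply H; now injection H'. Qed.

Lemma Cdiv_neq0 (a b : C) : a <> 0 -> b <> 0 -> a / b <> 0.
Proof.
intros Ha Hb H; apply Ha; replace a with (a / b * b) by (field; nonzero).
rewrite H; ring.
Qed.

(** * Coordinates on the lattice *)

Definition qh (E : equation) : C := RtoC (Rpower (q E) (1 / 2)).
Definition kq (E : equation) : C := qh E - / qh E.

(* Coefficients of sigma~ and tau as polynomials in the centred lattice x - c3. *)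
Definition st1 (E : equation) : C := stilde1 E + stilde2 E * c3 E.
Definition st0 (E : equation) : C :=
  stilde2 E / 2 * c3 E ^ 2 + stilde1 E * c3 E + stilde0 E.
Definition tt0 (E : equation) : C := ttilde1 E * c3 E + ttilde0 E.

(* In the following parameters sigma and Theta become Laurent polynomials in q^s, exchanged by
   c1 q^s <-> c2 q^(-s), and every structure constant is a combination of two powers of q. *)
Definition g1 (E : equation) : C := ttilde1 E / 2 + stilde2 E / 2 / kq E.
Definition g2 (E : equation) : C := ttilde1 E / 2 - stilde2 E / 2 / kq E.
Definition e1 (E : equation) : C := tt0 E / 2 + st1 E / kq E.
Definition e2 (E : equation) : C := tt0 E / 2 - st1 E / kq E.
Definition e0 (E : equation) : C :=
  st0 E + kq E * (g1 E - g2 E) * c1 E * c2 E.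

Definition lat (E : equation) (y : C) : C := c1 E * y + c2 E / y.
Definition sigy (E : equation) (y : C) : C :=
  kq E * (g1 E * c2 E ^ 2 / y ^ 2 - g2 E * c1 E ^ 2 * y ^ 2
          + e1 E * c2 E / y - e2 E * c1 E * y) + e0 E.
Definition they (E : equation) (y : C) : C :=
  kq E * (g1 E * c1 E ^ 2 * y ^ 2 - g2 E * c2 E ^ 2 / y ^ 2
          + e1 E * c1 E * y - e2 E * c2 E / y) + e0 E.

(* With M = q^(m/2): [m]_q, lambda_m / [m]_q, tau_m' and the offset tau_m(0) / tau_m' + c3. *)
Definition brk (E : equation) (M : C) : C := (M - / M) / kq E.
Definition Lam (E : equation) (M : C) : C :=
  - (g1 E * M / qh E + g2 E * qh E / M).
Definition tp (E : equation) (M : C) : C := g1 E * M ^ 2 + g2 E / M ^ 2.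
Definition off (E : equation) (M : C) : C := (e1 E * M + e2 E / M) / tp E M.
Definition bet (E : equation) (M : C) : C :=
  brk E M * off E (M / qh E) - brk E (M * qh E) * off E M.

(** The explicit value of h(n) at M = q^(n/2), so that r = q^((n+1)/2). It is what
    [identity_coefficient] leaves after all nonzero powers of q^s have cancelled. *)
Definition hconst (E : equation) (M : C) : C :=
  let r := M * qh E in
  Lam E M
  * (Lam E M * (c1 E * c2 E * (r ^ 2 + / r ^ 2) + off E M ^ 2)
     + c1 E * c2 E * (g1 E / qh E ^ 2 + g2 E * qh E ^ 2) * (r + / r)
     + (r - / r) * e0 E / kq E + off E M * (e1 E / qh E + e2 E * qh E)).

Record qparam (E : equation) : Prop := Qparam {
  qparam_pos : (0 < q E)%R;
  qparam_neq1 : q E <> 1%R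
}.

Lemma qh_sq (E : equation) : qparam E -> qh E ^ 2 = RtoC (q E).
Proof.
intros [H _]; unfold qh; rewrite <- RtoC_pow; f_equal.
rewrite <- Rpower_pow by apply exp_pos; rewrite Rpower_mult.
replace (1 / 2 * INR 2)%R with 1%R by (simpl; lra).
now apply Rpower_1.
Qed.

Lemma qh_neq0 (E : equation) : qh E <> 0.
Proof. apply RtoC_neq0; apply Rgt_not_eq, exp_pos. Qed.

Lemma qh_sq_sub1 (E : equation) : qparam E -> qh E ^ 2 - 1 <> 0.
Proof.
intros H; rewrite (qh_sq E H), <- RtoC_minus; apply RtoC_neq0.
destruct H as [_ H]; intros H'; apply H; lra.
Qed.

Lemma qh_sq_add1 (E : equation) : qparam E -> qh E ^ 2 + 1 <> 0.
Proof.
intros H; rewrite (qh_sq E H), <- RtoC_plus; apply RtoC_neq0.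
destruct H as [H _]; lra.
Qed.

Lemma kqE (E : equation) : kq E = (qh E ^ 2 - 1) / qh E.
Proof. unfold kq; field; apply qh_neq0. Qed.

Lemma kq_neq0 (E : equation) : qparam E -> kq E <> 0.
Proof.
intros H; rewrite kqE; apply Cdiv_neq0; [now apply qh_sq_sub1 | apply qh_neq0].
Qed.

Lemma qhn_neq0 (E : equation) (n : nat) : qh E ^ n <> 0.
Proof. apply Cpow_nz, qh_neq0. Qed.

Lemma qpow_half (E : equation) : qpow (q E) half = qh E.
Proof. apply qpow_RtoC. Qed.

Lemma qpow_one (E : equation) : qparam E -> qpow (q E) 1 = qh E ^ 2.
Proof.
intros H; rewrite (qpow_RtoC (q E) 1), qh_sq by trivial.
now rewrite Rpower_1 by apply H.
Qed.

Lemma Rpower_half_INR (E : equation) (n : nat) :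
  RtoC (Rpower (q E) (INR n / 2)) = qh E ^ n.
Proof.
unfold qh; rewrite <- RtoC_pow; f_equal.
rewrite <- Rpower_pow by apply exp_pos; rewrite Rpower_mult; f_equal; lra.
Qed.

Lemma Rpower_opp_half_INR (E : equation) (n : nat) :
  RtoC (Rpower (q E) (- INR n / 2)) = / qh E ^ n.
Proof.
rewrite <- Rpower_half_INR.
replace (- INR n / 2)%R with (- (INR n / 2))%R by lra.
rewrite Rpower_Ropp; apply RtoC_inv; apply Rgt_not_eq, exp_pos.
Qed.

Lemma qpow_INR (E : equation) (n : nat) :
  qpow (q E) (RtoC (INR n)) = (qh E ^ n) ^ 2.
Proof.
rewrite qpow_RtoC, <- Rpower_half_INR, <- RtoC_pow; f_equal; simpl.
rewrite Rmult_1_r, <- Rpower_plus; f_equal; lra.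
Qed.

Lemma xE (E : equation) (s : C) : x E s = lat E (qpow (q E) s) + c3 E.
Proof. unfold x, lat; rewrite qpow_opp; unfold Cdiv; ring. Qed.

Lemma qpow_add1 (E : equation) (s : C) : qparam E ->
  qpow (q E) (s + 1) = qpow (q E) s * qh E ^ 2.
Proof. intros H; now rewrite qpow_add, qpow_one. Qed.

Lemma qpow_sub1 (E : equation) (s : C) : qparam E ->
  qpow (q E) (s - 1) = qpow (q E) s / qh E ^ 2.
Proof.
intros H; unfold Cminus; rewrite qpow_add, qpow_opp, qpow_one by trivial.
reflexivity.
Qed.

Lemma qpow_sub_half (E : equation) (s : C) :
  qpow (q E) (s - half) = qpow (q E) s / qh E.
Proof. unfold Cminus; now rewrite qpow_add, qpow_opp, qpow_half. Qed.

Lemma DxE (E : equation) (s : C) : qparam E ->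
  Delta (x E) s = lat E (qpow (q E) s * qh E ^ 2) - lat E (qpow (q E) s).
Proof. intros H; unfold Delta; rewrite !xE, qpow_add1 by trivial; ring. Qed.

Lemma NxE (E : equation) (s : C) : qparam E ->
  Nabla (x E) s = lat E (qpow (q E) s) - lat E (qpow (q E) s / qh E ^ 2).
Proof. intros H; unfold Nabla; rewrite !xE, qpow_sub1 by trivial; ring. Qed.

Lemma DxmidE (E : equation) (s : C) : qparam E ->
  Dxmid E s = lat E (qpow (q E) s * qh E) - lat E (qpow (q E) s / qh E).
Proof.
intros H; unfold Dxmid; rewrite DxE, qpow_sub_half by trivial.
replace (qpow (q E) s / qh E * qh E ^ 2) with (qpow (q E) s * qh E)
  by (field; apply qh_neq0).
reflexivity.
Qed.

Lemma sigmaE (E : equation) (s : C) : qparam E ->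
  sigma E s = sigy E (qpow (q E) s).
Proof.
intros H; assert (Hy := qpow_neq0 (q E) s).
assert (H1 := qh_sq_sub1 E H); assert (H0 := qh_neq0 E).
unfold sigma, stilde, tau; rewrite DxmidE, xE by trivial.
unfold sigy, e0, e1, e2, g1, g2, tt0, st0, st1, lat, kq, half.
rewrite RtoC_div by lra.
field; nonzero.
Qed.

Lemma ThetaE (E : equation) (s : C) : qparam E ->
  Theta E s = they E (qpow (q E) s).
Proof.
intros H; assert (Hy := qpow_neq0 (q E) s).
assert (H1 := qh_sq_sub1 E H); assert (H0 := qh_neq0 E).
unfold Theta; rewrite (sigmaE E s H); unfold tau; rewrite DxmidE, xE by trivial.
unfold sigy, they, e0, e1, e2, g1, g2, tt0, st0, st1, lat, kq.
field; nonzero.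
Qed.

Lemma qnumE (E : equation) (n : nat) : qparam E ->
  RtoC (qnum (q E) (INR n)) = brk E (qh E ^ n).
Proof.
intros H; assert (H1 := kq_neq0 E H); unfold brk, kq in *; unfold qnum.
assert (H2 : RtoC (Rpower (q E) (- (1 / 2))) = / qh E).
{ unfold qh; rewrite Rpower_Ropp; apply RtoC_inv; apply Rgt_not_eq, exp_pos. }
rewrite RtoC_div, !RtoC_minus, Rpower_half_INR, Rpower_opp_half_INR, H2.
- reflexivity.
- intros H3; apply H1; rewrite <- H2; unfold qh.
  now rewrite <- RtoC_minus, H3.
Qed.

Lemma qalphaE (E : equation) (n : nat) :
  RtoC (qalpha (q E) (INR n)) = (qh E ^ n + / qh E ^ n) / 2.
Proof.
unfold qalpha.
now rewrite RtoC_div, RtoC_plus, Rpower_half_INR, Rpower_opp_half_INR by lra.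
Qed.

Lemma lambda_overE (E : equation) (n : nat) : qparam E ->
  lambda_over E n = Lam E (qh E ^ n).
Proof.
intros H; assert (H1 := qh_sq_sub1 E H); assert (H0 := qh_neq0 E).
assert (Hn := qhn_neq0 E n).
assert (Hp : forall r : R, RtoC (Rpower (q E) ((r - 1) / 2))
   = RtoC (Rpower (q E) (r / 2)) / qh E).
{ intros r; unfold qh; rewrite <- RtoC_div by apply Rgt_not_eq, exp_pos.
  f_equal; replace ((r - 1) / 2)%R with (r / 2 + - (1 / 2))%R by lra.
  now rewrite Rpower_plus, Rpower_Ropp. }
assert (Hm : forall r : R, RtoC (Rpower (q E) (- (r - 1) / 2))
   = RtoC (Rpower (q E) (- r / 2)) * qh E).
{ intros r; unfold qh; rewrite <- RtoC_mult.
  f_equal; replace (- (r - 1) / 2)%R with (- r / 2 + 1 / 2)%R by lra.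
  now rewrite Rpower_plus. }
assert (Hk : RtoC (Rpower (q E) (1/2) - Rpower (q E) (-(1/2))) = kq E).
{ rewrite RtoC_minus, Rpower_Ropp, RtoC_inv by apply Rgt_not_eq, exp_pos.
  reflexivity. }
unfold lambda_over, qnum, qalpha.
rewrite !RtoC_div, Hk, RtoC_plus, RtoC_minus, Hp, Hm, Rpower_half_INR,
  Rpower_opp_half_INR.
- unfold Lam, g1, g2, kq; field; nonzero.
- intros H3; apply (kq_neq0 E H); now rewrite <- Hk, H3.
- lra.
Qed.

Lemma lambdaE (E : equation) (n : nat) : qparam E ->
  lambda E n = brk E (qh E ^ n) * Lam E (qh E ^ n).
Proof. intros H; unfold lambda; now rewrite qnumE, lambda_overE. Qed.

Lemma qh_double (E : equation) (n : nat) : qh E ^ (2 * n) = (qh E ^ n) ^ 2.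
Proof. rewrite Nat.mul_comm; apply Cpow_mult_r. Qed.

Lemma INR_double (n : nat) : (2 * INR n)%R = INR (2 * n).
Proof. rewrite mult_INR; reflexivity. Qed.

Lemma tau_n'E (E : equation) (n : nat) : qparam E ->
  tau_n' E n = tp E (qh E ^ n).
Proof.
intros H; assert (H1 := qh_sq_sub1 E H); assert (H0 := qh_neq0 E).
assert (Hn := qhn_neq0 E n).
unfold tau_n'; rewrite INR_double, qnumE, qalphaE, qh_double by trivial.
unfold brk, tp, g1, g2, kq; field; nonzero.
Qed.

Lemma tau_n0E (E : equation) (n : nat) : qparam E ->
  tau_n0 E n = e1 E * qh E ^ n + e2 E / qh E ^ n - c3 E * tp E (qh E ^ n).
Proof.
intros H; assert (H1 := qh_sq_sub1 E H); assert (H0 := qh_neq0 E).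
assert (Hn := qhn_neq0 E n).
unfold tau_n0; cbv zeta.
rewrite !RtoC_minus, RtoC_mult, INR_double, !qnumE, !qalphaE, qh_double by trivial.
unfold brk, tp, e1, e2, g1, g2, tt0, st1, kq; field; nonzero.
Qed.

(** The numerator is Theta(s+n) - sigma(s). It is divisible by the denominator because both vanish
    when c1 (q^s q^(n/2))^2 = c2: there the exchange c1 q^s <-> c2 q^(-s) carries one of the two
    terms into the other. *)
Lemma tau_nE (E : equation) (n : nat) (s : C) :
  qparam E -> tau_regular E n s ->
  tau_n E n s = tp E (qh E ^ n) * lat E (qpow (q E) s * qh E ^ n)
                + (e1 E * qh E ^ n + e2 E / qh E ^ n).
Proof.
intros H Hr; assert (H1 := qh_sq_sub1 E H); assert (H0 := qh_neq0 E).
assert (Hn := qhn_neq0 E n); assert (Hy := qpow_neq0 (q E) s).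
unfold tau_n, tau_regular in *; cbv zeta.
assert (Hx : qpow (q E) (RtoC ((INR n - 1) / 2)) = qh E ^ n / qh E).
{ rewrite qpow_RtoC, <- Rpower_half_INR; unfold qh.
  rewrite <- RtoC_div by apply Rgt_not_eq, exp_pos; f_equal.
  replace ((INR n - 1) / 2)%R with (INR n / 2 + - (1 / 2))%R by lra.
  now rewrite Rpower_plus, Rpower_Ropp. }
assert (Hd : Delta (xk E (INR n - 1)) s
   = lat E (qpow (q E) s * qh E * qh E ^ n)
     - lat E (qpow (q E) s / qh E * qh E ^ n)).
{ unfold Delta, xk; rewrite !xE, !qpow_add, qpow_one, Hx by trivial.
  unfold lat; field; nonzero. }
rewrite Hd in *; clear Hd Hx.
match goal with |- ?a / _ = _ =>
  replace a with (Theta E (s + RtoC (INR n)) - sigma E s)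
    by (unfold Theta; ring) end.
rewrite ThetaE, sigmaE, qpow_add, qpow_INR by trivial.
unfold lat in Hr.
assert (Hr' : c1 E * (qpow (q E) s * qh E ^ n) ^ 2 - c2 E <> 0).
{ intros Z; apply Hr.
  transitivity ((c1 E * (qpow (q E) s * qh E ^ n) ^ 2 - c2 E)
                * ((qh E ^ 2 - 1) / qh E / (qpow (q E) s * qh E ^ n))).
  - field; nonzero.
  - rewrite Z; ring. }
assert (Hd := Cmult_neq_0 _ _ H1 Hr').
unfold sigy, they, tp, lat, kq.
field; nonzero.
Qed.

Lemma betaE (E : equation) (n : nat) : qparam E ->
  (forall m, (m <= n)%nat -> tau_n' E m <> 0) ->
  beta E n = bet E (qh E ^ n) + c3 E.
Proof.
intros H Ht; assert (H1 := qh_sq_sub1 E H); assert (H0 := qh_neq0 E).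
unfold beta; cbv zeta.
rewrite RtoC_minus, RtoC_plus, <- S_INR, !qnumE by trivial.
assert (Hn := Ht n (Nat.le_refl n)); rewrite tau_n'E in * by trivial.
rewrite tau_n0E by trivial; unfold bet, off.
assert (Hp := qhn_neq0 E n).
replace (qh E ^ S n) with (qh E ^ n * qh E) by (simpl; ring).
destruct n as [|m].
(* At n = 0 the first term of [beta] is 0 by convention. In [bet] the factor [0]_q = 0 removes [off]
   at q^(-1/2), whose denominator may vanish. *)
- replace (brk E (qh E ^ 0)) with (RtoC 0).
  + rewrite Cmult_0_l; field; auto.
  + assert (Hk := kq_neq0 E H); unfold brk; simpl; field; auto.
- assert (Hm := Ht m (Nat.le_succ_diag_r m)); rewrite tau_n'E in * by trivial.
  rewrite tau_n0E by trivial.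
  assert (Hp' := qhn_neq0 E m).
  replace (qh E ^ S m / qh E) with (qh E ^ m) by (simpl; field; auto).
  field; nonzero.
Qed.

Lemma uE (E : equation) (n : nat) (s : C) :
  qparam E -> tau_regular E n s -> tau_n' E n <> 0 ->
  u E s n = Lam E (qh E ^ n) * (lat E (qpow (q E) s * qh E ^ n) + off E (qh E ^ n))
            - sigy E (qpow (q E) s)
              / (lat E (qpow (q E) s) - lat E (qpow (q E) s / qh E ^ 2)).
Proof.
intros H Hr Ht; unfold u.
rewrite lambda_overE, NxE, sigmaE, tau_nE by trivial.
rewrite tau_n'E in * by trivial; unfold off.
assert (Hn := qhn_neq0 E n).
f_equal; field; auto.
Qed.

Lemma vE (E : equation) (n : nat) (s : C) :
  qparam E -> tau_regular E n s ->
  (forall m, (m <= n)%nat -> tau_n' E m <> 0) ->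
  v E s n = - Lam E (qh E ^ n) * (lat E (qpow (q E) s * qh E ^ n) + off E (qh E ^ n))
   + brk E (qh E ^ n) * Lam E (qh E ^ n)
     * (lat E (qpow (q E) s * qh E) - lat E (qpow (q E) s / qh E))
   + Lam E ((qh E ^ n) ^ 2) * (lat E (qpow (q E) s) - bet E (qh E ^ n))
   - they E (qpow (q E) s)
     / (lat E (qpow (q E) s * qh E ^ 2) - lat E (qpow (q E) s)).
Proof.
intros H Hr Ht; unfold v.
rewrite lambdaE, !lambda_overE, DxE, ThetaE, tau_nE, betaE, xE, DxmidE, qh_double
  by trivial.
assert (Hn := Ht n (Nat.le_refl n)).
rewrite tau_n'E in * by trivial; unfold off.
assert (Hp := qhn_neq0 E n).
f_equal; field; auto.
Qed.

(** This lemma and the next put nonvanishing hypotheses into the polynomial form of the side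
    conditions of [field]. *)
Lemma Dlat_neq0 (E : equation) (y : C) : qparam E -> y <> 0 ->
  lat E (y * qh E ^ 2) - lat E y <> 0 -> c1 E * (y * qh E) ^ 2 - c2 E <> 0.
Proof.
intros H Hy Hd Z; apply Hd.
assert (H1 := qh_sq_sub1 E H); assert (H0 := qh_neq0 E).
transitivity ((c1 E * (y * qh E) ^ 2 - c2 E) * ((qh E ^ 2 - 1) / qh E ^ 2 / y)).
- unfold lat; field; nonzero.
- rewrite Z; ring.
Qed.

Lemma tp_neq0 (E : equation) (M : C) : M <> 0 -> tp E M <> 0 ->
  g1 E * M ^ 2 * M ^ 2 + g2 E <> 0.
Proof.
intros Hm H Z; apply H.
transitivity ((g1 E * M ^ 2 * M ^ 2 + g2 E) / M ^ 2).
- unfold tp; field; auto.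
- rewrite Z; unfold Cdiv; ring.
Qed.

(** * The factorizations *)

(** With M = q^(n/2) and y = q^s this is v(s,n+1) = u(s+1,n). The poles on the two sides match
    because Theta(s) = sigma(s+1) wherever Delta x(s) = 0. *)
Lemma v_shift_u (E : equation) (M y : C) : qparam E -> M <> 0 -> y <> 0 ->
  lat E (y * qh E ^ 2) - lat E y <> 0 ->
  tp E M <> 0 -> tp E (M * qh E) <> 0 ->
  - Lam E (M * qh E) * (lat E (y * (M * qh E)) + off E (M * qh E))
   + brk E (M * qh E) * Lam E (M * qh E) * (lat E (y * qh E) - lat E (y / qh E))
   + Lam E ((M * qh E) ^ 2) * (lat E y - bet E (M * qh E))
   - they E y / (lat E (y * qh E ^ 2) - lat E y)
  = Lam E M * (lat E (y * qh E ^ 2 * M) + off E M)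
    - sigy E (y * qh E ^ 2) / (lat E (y * qh E ^ 2) - lat E y).
Proof.
intros H HM Hy Hd Ht Ht1.
assert (H1 := qh_sq_sub1 E H); assert (H0 := qh_neq0 E).
assert (Hd' := Dlat_neq0 E y H Hy Hd).
assert (Hp := Cmult_neq_0 _ _ H1 Hd').
apply tp_neq0 in Ht; trivial.
apply tp_neq0 in Ht1; [|now apply Cmult_neq_0].
unfold bet; replace (M * qh E / qh E) with M by (field; auto).
unfold Lam, brk, sigy, they, lat, off, tp, kq.
field; nonzero.
Qed.

(** The double pole of the product cancels against the last summand. The remaining simple pole is
    removable: where [lat E (y * qh E ^ 2) = lat E y], the exchange c1 y <-> c2 / y gives
    [they E y = sigy E (y * qh E ^ 2)] and equates [lat E (y * qh E ^ 2 * M)] with [lat E (y / M)].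
    In the resulting Laurent polynomial, [Lam] is the value that cancels the powers y^2 and y^(-2),
    and [off] the one that cancels y and 1/y. *)
Lemma identity_coefficient (E : equation) (M y : C) : qparam E -> M <> 0 -> y <> 0 ->
  lat E (y * qh E ^ 2) - lat E y <> 0 -> tp E M <> 0 ->
  (Lam E M * (lat E (y * qh E ^ 2 * M) + off E M)
   - sigy E (y * qh E ^ 2) / (lat E (y * qh E ^ 2) - lat E y))
  * (Lam E M * (lat E (y / M) + off E M)
     + they E y / (lat E (y * qh E ^ 2) - lat E y))
  + they E y * sigy E (y * qh E ^ 2) / (lat E (y * qh E ^ 2) - lat E y) ^ 2
  = hconst E M.
Proof.
intros H HM Hy Hd Ht.
assert (H1 := qh_sq_sub1 E H); assert (H0 := qh_neq0 E).
assert (Hd' := Dlat_neq0 E y H Hy Hd).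
assert (Hp := Cmult_neq_0 _ _ H1 Hd').
apply tp_neq0 in Ht; trivial.
unfold hconst, Lam, sigy, they, lat, off, tp, kq.
field; nonzero.
Qed.

Lemma standing_qparam (E : equation) (W : system) : standing E W -> qparam E.
Proof. intros H; split; [exact (q_pos E W H) | exact (q_neq1 E W H)]. Qed.

Lemma in_family_le (Sp : support) (m n : nat) :
  (m <= n)%nat -> in_family Sp n -> in_family Sp m.
Proof. destruct Sp; simpl; trivial; lia. Qed.

Lemma Cplus_sub1 (s : C) : s + 1 - 1 = s.
Proof. ring. Qed.

Lemma Csub_add1 (s : C) : s - 1 + 1 = s.
Proof. ring. Qed.

(** * The Pearson equation and the branch of the square root *)

Lemma pearson_Theta (E : equation) (W : system) (s : C) : standing E W ->
  dom W s -> dom W (s + 1) -> sigma E (s + 1) * rho W (s + 1) = Theta E s * rho W s.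
Proof.
intros H H1 H2; assert (H3 := pearson E W H s H1 H2); unfold Delta in H3.
unfold Theta.
replace (sigma E (s + 1) * rho W (s + 1))
  with (sigma E (s + 1) * rho W (s + 1) - sigma E s * rho W s
        + sigma E s * rho W s) by ring.
rewrite H3; ring.
Qed.

(** The identity survives the division by zero in [root]: if [sqrho] vanishes at s + 1 then so does
    [rho], and [root_defined] leaves only Theta(s) = 0, which makes both sides 0. The next two
    lemmas split in the same way. *)
Lemma root_mul_sqrho_succ (E : equation) (W : system) (s : C) : standing E W ->
  root_defined E W s -> root E W s * sqrho W (s + 1) = Theta E s * sqrho W s.
Proof.
intros H (H1 & H2 & H3); unfold root.
destruct (classic (sqrho W (s + 1) = 0)) as [Z|Z].
- destruct H3 as [H3|H3].
  + destruct H3; rewrite <- (sqrhoE E W H) by trivial; rewrite Z; ring.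
  + rewrite Z, H3; ring.
- field; trivial.
Qed.

Lemma root_mul_sqrho (E : equation) (W : system) (s : C) : standing E W ->
  root_defined E W s -> root E W s * sqrho W s = sigma E (s + 1) * sqrho W (s + 1).
Proof.
intros H (H1 & H2 & H3); unfold root.
assert (H4 := pearson_Theta E W s H H1 H2).
rewrite <- !(sqrhoE E W H) in H4 by trivial.
destruct (classic (sqrho W (s + 1) = 0)) as [Z|Z].
- destruct H3 as [H3|H3].
  + destruct H3; rewrite <- (sqrhoE E W H) by trivial; rewrite Z; ring.
  + rewrite Z, H3; unfold Cdiv; ring.
- transitivity (Theta E s * sqrho W s ^ 2 / sqrho W (s + 1)); [field; trivial|].
  rewrite <- H4; field; trivial.
Qed.

Lemma root_sq (E : equation) (W : system) (s : C) : standing E W ->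
  root_defined E W s -> root E W s ^ 2 = Theta E s * sigma E (s + 1).
Proof.
intros H H0.
assert (H5 := root_mul_sqrho_succ E W s H H0).
assert (H6 := root_mul_sqrho E W s H H0).
destruct (classic (sqrho W (s + 1) = 0)) as [Z|Z].
- destruct H0 as (H1 & H2 & [H3|H3]).
  + destruct H3; rewrite <- (sqrhoE E W H) by trivial; rewrite Z; ring.
  + unfold root; rewrite H3; unfold Cdiv; ring.
- transitivity (root E W s * (root E W s * sqrho W (s + 1)) / sqrho W (s + 1)).
  + field; trivial.
  + rewrite H5.
    transitivity (Theta E s * (root E W s * sqrho W s) / sqrho W (s + 1)).
    * field; trivial.
    * rewrite H6; field; trivial.
Qed.

(** This form also holds where [Dxmid] is 0 and [P_solves] says nothing. There x(s+1) = x(s-1),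
    because x(s+1) - x(s-1) is a multiple of [Dxmid], so the two difference quotients of a
    polynomial in x coincide, and Theta(s) = sigma(s). *)
Lemma difference_equation (E : equation) (W : system) (n : nat) (s : C) :
  standing E W -> in_family (supp W) n ->
  Delta (x E) s <> 0 -> Nabla (x E) s <> 0 ->
  Theta E s * (Delta (Px E W n) s / Delta (x E) s)
  - sigma E s * (Nabla (Px E W n) s / Nabla (x E) s)
  + lambda E n * Dxmid E s * Px E W n s = 0.
Proof.
intros H Hn Hd Hm.
destruct (classic (Dxmid E s = 0)) as [Z|Z].
- assert (Hx : x E (s + 1) = x E (s - 1)).
  { assert (Hq := standing_qparam E W H); assert (H0 := qh_neq0 E).
    assert (Hy := qpow_neq0 (q E) s).
    assert (Hk : x E (s + 1) - x E (s - 1) = (qh E + / qh E) * Dxmid E s).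
    { rewrite DxmidE, !xE, qpow_add1, qpow_sub1 by trivial.
      unfold lat; field; auto. }
    rewrite Z, Cmult_0_r in Hk; now apply Ceq_minus. }
  unfold Theta; rewrite Z; unfold Delta, Nabla, Px in *.
  rewrite Hx in *; field; auto.
- assert (H1 := P_solves E W H n Hn s Hd Hm Z); unfold solves_at in H1.
  unfold Delta at 1 in H1.
  replace (Nabla (Px E W n) (s + 1)) with (Delta (Px E W n) s) in H1
    by (unfold Nabla, Delta; now rewrite Cplus_sub1).
  replace (Nabla (x E) (s + 1)) with (Delta (x E) s) in H1
    by (unfold Nabla, Delta; now rewrite Cplus_sub1).
  unfold Theta.
  rewrite <- (Cmult_0_l (Dxmid E s)), <- H1; field; auto.
Qed.

Lemma Hop_phi (E : equation) (W : system) (n : nat) (s : C) :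
  standing E W -> in_family (supp W) n -> H_regular E W s ->
  Hop E W n (phi E W n) s = 0.
Proof.
intros H Hn (Hd & Hm & Hr & Hr').
assert (H1 := difference_equation E W n s H Hn Hd Hm).
assert (H2 := root_mul_sqrho_succ E W s H Hr).
assert (H3 := root_mul_sqrho E W (s - 1) H Hr').
rewrite Csub_add1 in H3.
assert (H4 := dnorm_neq0 E W H n Hn).
unfold Hop, op_sub, op_add, op_mul, Eminus, Eplus, Iop, phi.
transitivity (root E W (s - 1) * sqrho W (s - 1) * (Px E W n (s - 1) / Nabla (x E) s / dnorm W n)
  + root E W s * sqrho W (s + 1) * (Px E W n (s + 1) / Delta (x E) s / dnorm W n)
  - (Theta E s / Delta (x E) s + sigma E s / Nabla (x E) s
     - lambda E n * Dxmid E s) * (sqrho W s / dnorm W n * Px E W n s)).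
- field; auto.
- rewrite H2, H3.
  transitivity (0 * (sqrho W s / dnorm W n)); [rewrite <- H1|ring].
  change (Delta (Px E W n) s) with (Px E W n (s + 1) - Px E W n s).
  change (Nabla (Px E W n) s) with (Px E W n s - Px E W n (s - 1)).
  field; auto.
Qed.

(** In L^- L^+ the coefficients of E^- and E^+ are those of H times v(s,n+1) and u(s+1,n)
    respectively, and these factors agree by [Hv]. The product of the two shift terms adds root(s)^2
    / (Delta x(s))^2 to the coefficient of I, which [Hk] accounts for. *)
Lemma factorization_mp (E : equation) (W : system) (n : nat) :
  standing E W -> in_family (supp W) (S n) -> hmp E W n = hconst E (qh E ^ n) ->
  op_eq_on (regular_mp E W n)
    (op_mul (fun s => u E (s + 1) n) (Hop E W n))
    (op_sub (op_comp (Lminus E W (S n)) (Lplus E W n))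
            (op_mul (fun _ => hmp E W n) Iop)).
Proof.
intros H Hn Hh f s ((Hd & Hm & Hr & Hr') & Ht & Ht1 & HtS).
assert (Hq := standing_qparam E W H).
assert (Htau : forall m, (m <= S n)%nat -> tau_n' E m <> 0).
{ intros m Hm'; apply (tau_n'_neq0 E W H); now apply in_family_le with (S n). }
assert (Htn : tp E (qh E ^ n) <> 0) by (rewrite <- tau_n'E by trivial; auto).
assert (HtS' : tp E (qh E ^ n * qh E) <> 0).
{ rewrite Cmult_comm; change (tp E (qh E ^ S n) <> 0).
  rewrite <- tau_n'E by trivial; auto. }
assert (Hd' := Hd); rewrite DxE in Hd' by trivial.
assert (Hv : v E s (S n) = u E (s + 1) n).
{ rewrite vE, uE, qpow_add1 by auto.
  replace (qh E ^ S n) with (qh E ^ n * qh E) by (simpl; ring).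
  replace (qpow (q E) s * qh E ^ 2 / qh E ^ 2) with (qpow (q E) s)
    by (field; apply qh_neq0).
  apply v_shift_u; trivial; [apply qhn_neq0 | apply qpow_neq0]. }
assert (Hk : hmp E W n = u E (s + 1) n
  * (u E s n + Theta E s / Delta (x E) s + sigma E s / Nabla (x E) s
     - lambda E n * Dxmid E s) + root E W s ^ 2 / Delta (x E) s ^ 2).
{ rewrite Hh, <- (identity_coefficient E (qh E ^ n) (qpow (q E) s)), root_sq,
    !uE, lambdaE, !ThetaE, !sigmaE, NxE, !DxE, DxmidE, !qpow_add1; trivial; auto.
  - replace (qpow (q E) s * qh E ^ 2 / qh E ^ 2) with (qpow (q E) s)
      by (field; apply qh_neq0).
    f_equal; f_equal.
    (* [n]_q (x(s+1/2) - x(s-1/2)) = x(s+n/2) - x(s-n/2), so the lambda_n term moves the lattice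
       point from s + n/2 to s - n/2. *)
    replace (Lam E (qh E ^ n) * (lat E (qpow (q E) s / qh E ^ n) + off E (qh E ^ n)))
      with (Lam E (qh E ^ n) * (lat E (qpow (q E) s * qh E ^ n) + off E (qh E ^ n))
         - brk E (qh E ^ n) * Lam E (qh E ^ n)
           * (lat E (qpow (q E) s * qh E) - lat E (qpow (q E) s / qh E))).
    + ring.
    + assert (Hy := qpow_neq0 (q E) s); assert (H1 := qh_sq_sub1 E Hq).
      assert (H0 := qh_neq0 E); assert (HM := qhn_neq0 E n).
      unfold lat, brk, kq; field; nonzero.
  - apply qhn_neq0.
  - apply qpow_neq0. }
unfold op_sub, op_comp, Lminus, Lplus, Hop, op_sub, op_add, op_mul, Eplus,
  Eminus, Iop.
rewrite Hv, Hk, Cplus_sub1.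
replace (Nabla (x E) (s + 1)) with (Delta (x E) s)
  by (unfold Nabla, Delta; now rewrite Cplus_sub1).
field; auto.
Qed.

(** In this order the inner operator is evaluated at s - 1, so the coefficient of I is the
    expression of [identity_coefficient] at q^(s-1). The constant is the same one because that
    expression does not depend on s. *)
Lemma factorization_pm (E : equation) (W : system) (n : nat) :
  standing E W -> in_family (supp W) (S n) -> hmp E W n = hconst E (qh E ^ n) ->
  op_eq_on (regular_pm E W n)
    (op_mul (fun s => u E s n) (Hop E W (S n)))
    (op_sub (op_comp (Lplus E W n) (Lminus E W (S n)))
            (op_mul (fun _ => hmp E W n) Iop)).
Proof.
intros H Hn Hh f s ((Hd & Hm & Hr & Hr') & Ht & HtS & HtS').
assert (Hq := standing_qparam E W H).
assert (Htau : forall m, (m <= S n)%nat -> tau_n' E m <> 0).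
{ intros m Hm'; apply (tau_n'_neq0 E W H); now apply in_family_le with (S n). }
assert (Htn : tp E (qh E ^ n) <> 0) by (rewrite <- tau_n'E by trivial; auto).
assert (HtSn : tp E (qh E ^ n * qh E) <> 0).
{ rewrite Cmult_comm; change (tp E (qh E ^ S n) <> 0).
  rewrite <- tau_n'E by trivial; auto. }
assert (Hd' := Hd); rewrite DxE in Hd' by trivial.
assert (Hm' := Hm); rewrite NxE in Hm' by trivial.
assert (Hy := qpow_neq0 (q E) s); assert (H1 := qh_sq_sub1 E Hq).
assert (H0 := qh_neq0 E); assert (HM := qhn_neq0 E n).
assert (Hy' : qpow (q E) s / qh E ^ 2 <> 0)
  by (apply Cdiv_neq0; trivial; now apply Cpow_nz).
assert (Hyy : qpow (q E) s / qh E ^ 2 * qh E ^ 2 = qpow (q E) s) by (field; auto).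
assert (HS : qh E ^ S n = qh E ^ n * qh E) by (simpl; ring).
assert (Hv : v E (s - 1) (S n) = u E s n).
{ rewrite vE, uE, qpow_sub1, HS by auto.
  rewrite v_shift_u; trivial; rewrite ?Hyy; trivial. }
assert (Hw : v E s (S n) = Lam E (qh E ^ n)
    * (lat E (qpow (q E) s * qh E ^ 2 * qh E ^ n) + off E (qh E ^ n))
    - sigy E (qpow (q E) s * qh E ^ 2)
      / (lat E (qpow (q E) s * qh E ^ 2) - lat E (qpow (q E) s))).
{ rewrite vE, HS by auto; now apply v_shift_u. }
assert (Hk : hmp E W n = u E s n
  * (v E s (S n) + Theta E s / Delta (x E) s + sigma E s / Nabla (x E) s
     - lambda E (S n) * Dxmid E s) + root E W (s - 1) ^ 2 / Nabla (x E) s ^ 2).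
{ rewrite Hh, <- (identity_coefficient E (qh E ^ n) (qpow (q E) s / qh E ^ 2)),
    root_sq, Hw, uE, lambdaE, !ThetaE, Csub_add1, !sigmaE, NxE, !DxE, DxmidE,
    !qpow_sub1, !Hyy, HS; trivial; auto; [|now rewrite Hyy].
  f_equal; f_equal.
  assert (Hd2 := Dlat_neq0 E _ Hq Hy Hd').
  assert (Hm2 := Dlat_neq0 E (qpow (q E) s / qh E ^ 2) Hq Hy').
  rewrite Hyy in Hm2; specialize (Hm2 Hm').
  assert (Hd3 := Cmult_neq_0 _ _ H1 Hd2).
  assert (Hm3 : c1 E * qpow (q E) s ^ 2 - c2 E * qh E ^ 2 <> 0).
  { intros Z; apply Hm2.
    transitivity ((c1 E * qpow (q E) s ^ 2 - c2 E * qh E ^ 2) / qh E ^ 2).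
    - field; auto.
    - rewrite Z; unfold Cdiv; ring. }
  assert (Hm4 := Cmult_neq_0 _ _ H1 Hm3).
  unfold Lam, brk, sigy, they, lat, kq.
  field; nonzero. }
unfold op_sub, op_comp, Lminus, Lplus, Hop, op_sub, op_add, op_mul, Eplus,
  Eminus, Iop.
rewrite Hv, Hk, Csub_add1.
replace (Delta (x E) (s - 1)) with (Nabla (x E) s)
  by (unfold Nabla, Delta; now rewrite Csub_add1).
field; auto.
Qed.

(** * Polynomials on the lattice *)

Fixpoint ev (l : list C) (z : C) : C :=
  match l with nil => 0 | (a :: l)%list => a + z * ev l z end.

(** The list may end in zeros, so the bound need not be sharp, and d = 0 forces F = 0. *)
Definition deg_lt (d : nat) (F : C -> C) : Prop :=
  exists l, length l = d /\ forall z, F z = ev l z.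

Definition ispoly (F : C -> C) : Prop := exists d, deg_lt d F.

Lemma ev_app (l l' : list C) (z : C) :
  ev (l ++ l') z = ev l z + z ^ length l * ev l' z.
Proof. induction l as [|a l IH]; simpl; [|rewrite IH]; ring. Qed.

Lemma ev_repeat0 (d : nat) (z : C) : ev (repeat (RtoC 0) d) z = 0.
Proof. induction d as [|d IH]; simpl; [|rewrite IH]; ring. Qed.

Lemma deg_lt_ext (d : nat) (F G : C -> C) :
  (forall z, F z = G z) -> deg_lt d F -> deg_lt d G.
Proof.
intros H (l & Hl & HF); exists l; split; trivial.
intros z; now rewrite <- H.
Qed.

Lemma deg_lt_zero (d : nat) : deg_lt d (fun _ => 0).
Proof.
exists (repeat (RtoC 0) d); split; [apply repeat_length|].
intros z; now rewrite ev_repeat0.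
Qed.

Lemma deg_lt_weaken (d d' : nat) (F : C -> C) :
  (d <= d')%nat -> deg_lt d F -> deg_lt d' F.
Proof.
intros H (l & Hl & HF); exists (l ++ repeat (RtoC 0) (d' - d))%list; split.
- rewrite length_app, repeat_length; lia.
- intros z; rewrite ev_app, ev_repeat0, HF; ring.
Qed.

Lemma deg_lt_scal (d : nat) (a : C) (F : C -> C) :
  deg_lt d F -> deg_lt d (fun z => a * F z).
Proof.
intros (l & Hl & HF); exists (map (Cmult a) l); split.
- now rewrite length_map.
- intros z; rewrite HF; clear Hl HF.
  induction l as [|b l IH]; simpl; [|rewrite <- IH]; ring.
Qed.

Lemma ev_plus (l l' : list C) : length l = length l' ->
  exists l'', length l'' = length l /\ forall z, ev l z + ev l' z = ev l'' z.
Proof.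
revert l'; induction l as [|a l IH]; intros [|b l'] H; simpl in H; try discriminate.
- exists nil; split; trivial; intros z; simpl; ring.
- destruct (IH l') as (l'' & H1 & H2); [lia|].
  exists (a + b :: l'')%list; split; simpl; [lia|].
  intros z; rewrite <- H2; ring.
Qed.

Lemma deg_lt_plus (d : nat) (F G : C -> C) :
  deg_lt d F -> deg_lt d G -> deg_lt d (fun z => F z + G z).
Proof.
intros (l & Hl & HF) (l' & Hl' & HG).
destruct (ev_plus l l') as (l'' & H1 & H2); [lia|].
exists l''; split; [lia|]; intros z; now rewrite HF, HG.
Qed.

Lemma deg_lt_mulX (d : nat) (F : C -> C) :
  deg_lt d F -> deg_lt (S d) (fun z => z * F z).
Proof.
intros (l & Hl & HF); exists (RtoC 0 :: l)%list; split; simpl; [lia|].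
intros z; rewrite HF; ring.
Qed.

Lemma deg_lt_const (a : C) : deg_lt 1 (fun _ => a).
Proof. exists (a :: nil)%list; split; trivial; intros z; simpl; ring. Qed.

Lemma deg_lt_pow (n : nat) : deg_lt (S n) (fun z => z ^ n).
Proof.
induction n as [|n IH]; [exact (deg_lt_const 1) | exact (deg_lt_mulX _ _ IH)].
Qed.

Lemma deg_lt_S (d : nat) (F : C -> C) : deg_lt (S d) F ->
  exists a G, deg_lt d G /\ forall z, F z = a * z ^ d + G z.
Proof.
intros (l & Hl & HF).
destruct (exists_last (l := l)) as (l' & a & ->); [now destruct l|].
rewrite length_app in Hl; simpl in Hl.
exists a, (ev l'); split.
- exists l'; split; [lia | trivial].
- intros z; rewrite HF, ev_app; replace (length l') with d by lia; simpl; ring.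
Qed.

Lemma ispoly_ext (F G : C -> C) : (forall z, F z = G z) -> ispoly F -> ispoly G.
Proof. intros H (d & Hd); exists d; now apply deg_lt_ext with F. Qed.

Lemma ispoly_const (a : C) : ispoly (fun _ => a).
Proof. exists 1%nat; apply deg_lt_const. Qed.

Lemma ispoly_id : ispoly (fun z => z).
Proof.
exists 2%nat; apply deg_lt_ext with (fun z => z ^ 1); [|apply deg_lt_pow].
intros z; apply Cpow_1_r.
Qed.

Lemma ispoly_plus (F G : C -> C) :
  ispoly F -> ispoly G -> ispoly (fun z => F z + G z).
Proof.
intros (d & Hd) (d' & Hd'); exists (max d d').
apply deg_lt_plus; [apply deg_lt_weaken with d | apply deg_lt_weaken with d'];
  trivial; lia.
Qed.

Lemma ispoly_mult (F G : C -> C) :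
  ispoly F -> ispoly G -> ispoly (fun z => F z * G z).
Proof.
intros (d & l & _ & HF) HG.
apply ispoly_ext with (fun z => ev l z * G z); [intros z; now rewrite HF|].
clear HF; induction l as [|a l (d' & IH)]; simpl.
- apply ispoly_ext with (fun _ => 0); [intros z; ring | apply ispoly_const].
- apply ispoly_ext with (fun z => a * G z + z * (ev l z * G z)).
  + intros z; ring.
  + apply ispoly_plus.
    * destruct HG as (e & HG); exists e; now apply deg_lt_scal.
    * exists (S d'); now apply deg_lt_mulX.
Qed.

Lemma ispoly_minus (F G : C -> C) :
  ispoly F -> ispoly G -> ispoly (fun z => F z - G z).
Proof.
intros HF HG; apply ispoly_ext with (fun z => F z + (-(1)) * G z).
- intros z; ring.
- apply ispoly_plus; trivial; apply ispoly_mult; trivial; apply ispoly_const.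
Qed.

Ltac ispoly_tac :=
  repeat first [ assumption | apply ispoly_const | apply ispoly_id
               | apply ispoly_minus | apply ispoly_plus | apply ispoly_mult ].

Lemma ev_factor (a : C) (l : list C) (r : C) : exists l', length l' = length l /\
  forall z, ev (a :: l) z = ev (a :: l) r + (z - r) * ev l' z.
Proof.
revert a; induction l as [|b l IH]; intros a.
- exists nil; split; trivial; intros z; simpl; ring.
- destruct (IH b) as (l' & H1 & H2).
  exists (ev (b :: l) r :: l')%list; split; simpl; [lia|].
  intros z; assert (H3 := H2 z); simpl in H3; rewrite H3; ring.
Qed.

(** [Hw] replaces injectivity, which fails for lattice values: q^s and its image under c1 q^s <-> c2
    q^(-s) give the same x. After a root w n0 is divided out, all late indices avoid the value w n0,
    so their roots pass to the quotient. *)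
Lemma ev_infinite_roots (w : nat -> C)
  (Hw : forall v, exists N, forall n, (N <= n)%nat -> w n <> v) (l : list C) :
  (forall N, exists n, (N <= n)%nat /\ ev l (w n) = 0) -> forall z, ev l z = 0.
Proof.
remember (length l) as d eqn:Hd; revert l Hd.
induction d as [|d IH]; intros [|a l] Hd Hz z; try discriminate; trivial.
destruct (Hz 0%nat) as (n0 & _ & H0).
destruct (ev_factor a l (w n0)) as (l' & H1 & H2).
rewrite H2, H0, (IH l'); [ring | simpl in Hd; lia |].
intros N; destruct (Hw (w n0)) as (N' & HN').
destruct (Hz (max N N')) as (n & Hn & H3); exists n; split; [lia|].
rewrite H2, H0, Cplus_0_l in H3.
destruct (classic (ev l' (w n) = 0)) as [Z|Z]; trivial.
destruct (Cmult_neq_0 (w n - w n0) (ev l' (w n))); trivial.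
apply Cminus_eq_contra, HN'; lia.
Qed.

(** The constant coefficient is the value at 0. The tail then vanishes at every positive integer,
    hence identically. *)
Lemma ev_zero_coef (l : list C) :
  (forall z, ev l z = 0) -> forall a, In a l -> a = 0.
Proof.
induction l as [|b l IH]; intros H a; simpl; [tauto|].
assert (Hb : b = 0) by (generalize (H 0); simpl; intros H0; rewrite <- H0; ring).
intros [<-|Ha]; trivial; apply IH; trivial.
apply (ev_infinite_roots (fun n => RtoC (INR (S n)))).
- intros v; destruct (classic (exists m, RtoC (INR (S m)) = v)) as [(m & <-)|Hv].
  + exists (S m); intros n Hn H1; injection H1; intros H2.
    apply (not_INR (S n) (S m)); [lia | exact H2].
  + exists 0%nat; intros n _ H1; apply Hv; now exists n.
- intros N; exists N; split; trivial.
  assert (HN : RtoC (INR (S N)) <> 0) by (apply RtoC_neq0, not_0_INR; lia).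
  destruct (classic (ev l (RtoC (INR (S N))) = 0)) as [Z|Z]; trivial.
  destruct (Cmult_neq_0 _ _ HN Z).
  assert (H1 := H (RtoC (INR (S N)))); cbn [ev] in H1; rewrite Hb in H1.
  rewrite <- H1; ring.
Qed.

Lemma top_coefs_zero (d : nat) (a b : C) (F : C -> C) : deg_lt d F ->
  (forall z, a * z ^ S d + b * z ^ d + F z = 0) -> b = 0.
Proof.
intros (l & Hl & HF) H.
apply (ev_zero_coef (l ++ b :: a :: nil)%list).
- intros z; rewrite ev_app, Hl, <- HF.
  transitivity (a * z ^ S d + b * z ^ d + F z); [simpl; ring | apply H].
- apply in_or_app; right; now left.
Qed.

Lemma qpow_INR_finite (E : equation) : qparam E ->
  forall v, exists N, forall n, (N <= n)%nat -> qpow (q E) (RtoC (INR n)) <> v.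
Proof.
intros [H1 H2] v.
destruct (classic (exists m, qpow (q E) (RtoC (INR m)) = v)) as [(m & <-)|Hv].
- exists (S m); intros n Hn H3; rewrite !qpow_RtoC in H3; injection H3; intros H4.
  apply exp_inv in H4; apply Rmult_eq_reg_r in H4; [|now apply ln_neq_0].
  apply INR_eq in H4; lia.
- exists 0%nat; intros n _ H3; apply Hv; now exists n.
Qed.

Definition zs (E : equation) (s : C) : C := lat E (qpow (q E) s).

Definition generic (E : equation) (s : C) : Prop :=
  Delta (x E) s <> 0 /\ Nabla (x E) s <> 0 /\ Dxmid E s <> 0.

Lemma quadratic_eventually_neq0 (E : equation) (a b c : C) : qparam E ->
  a <> 0 \/ c <> 0 -> exists N, forall n, (N <= n)%nat ->
  let y := qpow (q E) (RtoC (INR n)) in a + b * y + c * y ^ 2 <> 0.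
Proof.
intros H Hac; apply NNPP; intros Hn.
assert (Hz : forall z, ev (a :: b :: c :: nil) z = 0).
{ apply (ev_infinite_roots (fun n => qpow (q E) (RtoC (INR n)))).
  - now apply qpow_INR_finite.
  - intros N; apply NNPP; intros Hn'; apply Hn; exists N; intros n HN y Hy.
    apply Hn'; exists n; split; trivial.
    rewrite <- Hy; unfold y; simpl; ring. }
assert (Hc := ev_zero_coef _ Hz).
destruct Hac as [Ha|Hc']; [apply Ha | apply Hc']; apply Hc; simpl; tauto.
Qed.

(** Up to a nonzero factor, each of the three differences is c1 b y^2 - c2 a at y = q^n with a, b
    nonzero. This quadratic is not the zero polynomial, and the powers q^n are distinct. *)
Lemma generic_eventually (E : equation) : qparam E -> c1 E <> 0 \/ c2 E <> 0 ->
  exists N, forall n, (N <= n)%nat -> generic E (RtoC (INR n)).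
Proof.
intros H Hc; assert (H1 := qh_sq_sub1 E H); assert (H0 := qh_neq0 E).
assert (Hopp : forall a b : C, a <> 0 -> b <> 0 -> - a * b <> 0).
{ intros a b Ha Hb Z; apply (Cmult_neq_0 a b Ha Hb).
  replace (a * b) with (- (- a * b)) by ring; rewrite Z; ring. }
assert (H2 : qh E ^ 2 <> 0) by (now apply Cpow_nz).
assert (H3 : RtoC 1 <> 0) by (apply RtoC_neq0; lra).
assert (Hq : forall a b : C, a <> 0 -> b <> 0 -> exists N, forall n, (N <= n)%nat ->
  let y := qpow (q E) (RtoC (INR n)) in - c2 E * a + 0 * y + c1 E * b * y ^ 2 <> 0).
{ intros a b Ha Hb; apply quadratic_eventually_neq0; trivial.
  destruct Hc as [Hc|Hc]; [right | left]; [now apply Cmult_neq_0 | now apply Hopp]. }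
destruct (Hq 1 (qh E ^ 2)) as (N1 & HN1); trivial.
destruct (Hq (qh E ^ 2) 1) as (N2 & HN2); trivial.
destruct (Hq 1 1) as (N3 & HN3); trivial.
exists (max N1 (max N2 N3)); intros n Hn.
specialize (HN1 n ltac:(lia)); specialize (HN2 n ltac:(lia));
  specialize (HN3 n ltac:(lia)); cbv zeta in *.
assert (Hy := qpow_neq0 (q E) (RtoC (INR n))).
unfold generic; rewrite DxE, NxE, DxmidE by trivial.
set (y := qpow (q E) (RtoC (INR n))) in *.
split; [|split]; unfold lat.
- replace (c1 E * (y * qh E ^ 2) + c2 E / (y * qh E ^ 2) - (c1 E * y + c2 E / y))
    with ((- c2 E * 1 + 0 * y + c1 E * qh E ^ 2 * y ^ 2)
          * ((qh E ^ 2 - 1) / qh E ^ 2 / y)) by (field; auto).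
  apply Cmult_neq_0; trivial; repeat apply Cdiv_neq0; trivial.
- replace (c1 E * y + c2 E / y - (c1 E * (y / qh E ^ 2) + c2 E / (y / qh E ^ 2)))
    with ((- c2 E * qh E ^ 2 + 0 * y + c1 E * 1 * y ^ 2)
          * ((qh E ^ 2 - 1) / qh E ^ 2 / y)) by (field; auto).
  apply Cmult_neq_0; trivial; repeat apply Cdiv_neq0; trivial.
- replace (c1 E * (y * qh E) + c2 E / (y * qh E) - (c1 E * (y / qh E) + c2 E / (y / qh E)))
    with ((- c2 E * 1 + 0 * y + c1 E * 1 * y ^ 2)
          * ((qh E ^ 2 - 1) / qh E / y)) by (field; auto).
  apply Cmult_neq_0; trivial; repeat apply Cdiv_neq0; trivial.
Qed.

Lemma poly_zero_on_lattice (E : equation) (F : C -> C) :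
  qparam E -> c1 E <> 0 \/ c2 E <> 0 -> ispoly F ->
  (forall s, generic E s -> F (zs E s) = 0) -> forall z, F z = 0.
Proof.
intros H Hc (d & l & _ & HF) Hz z; rewrite HF.
destruct (generic_eventually E H Hc) as (N0 & HN0).
apply (ev_infinite_roots (fun n => zs E (RtoC (INR n)))).
- intros v.
  (* The equation c1 y + c2 / y = v becomes c2 - v y + c1 y^2 = 0, so the lattice takes each value
     only finitely often along s = n. *)
  destruct (quadratic_eventually_neq0 E (c2 E) (- v) (c1 E) H) as (N & HN);
    [tauto|].
  exists N; intros n Hn Hv; apply (HN n Hn); cbv zeta.
  assert (Hy := qpow_neq0 (q E) (RtoC (INR n))).
  rewrite <- Hv; unfold zs, lat; field; trivial.
- intros N; exists (max N N0); split; [lia|].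
  rewrite <- HF; apply Hz, HN0; lia.
Qed.

(** * The difference operator on polynomials *)

(* G is the polynomial D F, where [Dxmid * (D F) = Theta * (Delta F / Delta x) -
   sigma * (nabla F / nabla x)] is the difference operator with eigenvalues [- lambda_n]. *)
Definition Drel (E : equation) (F G : C -> C) : Prop :=
  forall s, generic E s -> let y := qpow (q E) s in
  they E y * ((F (lat E (y * qh E ^ 2)) - F (lat E y))
              / (lat E (y * qh E ^ 2) - lat E y))
  - sigy E y * ((F (lat E y) - F (lat E (y / qh E ^ 2)))
                / (lat E y - lat E (y / qh E ^ 2)))
  = (lat E (y * qh E) - lat E (y / qh E)) * G (lat E y).

Lemma generic_lat (E : equation) (s : C) : qparam E -> generic E s ->
  let y := qpow (q E) s in
  lat E (y * qh E ^ 2) - lat E y <> 0 /\ lat E y - lat E (y / qh E ^ 2) <> 0 /\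
  lat E (y * qh E) - lat E (y / qh E) <> 0.
Proof.
intros H; unfold generic; now rewrite DxE, NxE, DxmidE by trivial.
Qed.

Lemma Drel_ext (E : equation) (F F' G G' : C -> C) :
  (forall z, F z = F' z) -> (forall z, G z = G' z) -> Drel E F G -> Drel E F' G'.
Proof. intros HF HG H s Hs y; rewrite <- !HF, <- HG; now apply H. Qed.

Lemma Drel_lin (E : equation) (a b : C) (F F' G G' : C -> C) : qparam E ->
  Drel E F G -> Drel E F' G' ->
  Drel E (fun z => a * F z + b * F' z) (fun z => a * G z + b * G' z).
Proof.
intros Hq H H' s Hs y.
destruct (generic_lat E s Hq Hs) as (H1 & H2 & _).
specialize (H s Hs); specialize (H' s Hs); cbv zeta in *; fold y in H, H', H1, H2.
transitivity (a * ((lat E (y * qh E) - lat E (y / qh E)) * G (lat E y))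
  + b * ((lat E (y * qh E) - lat E (y / qh E)) * G' (lat E y))).
- rewrite <- H, <- H'; field; auto.
- ring.
Qed.

Definition bq (E : equation) : C := qh E ^ 2 + / qh E ^ 2.
Definition Kq (E : equation) : C := c1 E * c2 E * (4 - bq E ^ 2).
Definition r2 (E : equation) : C :=
  (qh E + / qh E) * (stilde2 E / 2) + (1 - bq E / 2) * ttilde1 E.
Definition r1 (E : equation) : C :=
  (qh E + / qh E) * st1 E + (1 - bq E / 2) * tt0 E.
Definition r0 (E : equation) : C := (qh E + / qh E) * st0 E.
Definition Rq (E : equation) (z : C) : C := r2 E * z ^ 2 + r1 E * z + r0 E.

(* z^2 D - (q + 1/q) z D z + D z^2 = K D + R, because
   x(s)^2 - (q + 1/q) x(s) x(s+1) + x(s+1)^2 is constant when c3 = 0. *)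
Lemma Drel_mulX2 (E : equation) (F G N : C -> C) : qparam E ->
  Drel E F G -> Drel E (fun z => z * F z) N ->
  Drel E (fun z => z ^ 2 * F z)
    (fun z => bq E * z * N z - z ^ 2 * G z + Kq E * G z + Rq E z * F z).
Proof.
intros Hq H H' s Hs y.
destruct (generic_lat E s Hq Hs) as (H1 & H2 & _).
specialize (H s Hs); specialize (H' s Hs); cbv zeta in *; fold y in H, H', H1, H2.
assert (Hy : y <> 0) by apply qpow_neq0.
assert (H3 := qh_sq_sub1 E Hq); assert (H0 := qh_neq0 E).
assert (H4 := Dlat_neq0 E y Hq Hy H1).
assert (Hy' : y / qh E ^ 2 <> 0)
  by (apply Cdiv_neq0; trivial; now apply Cpow_nz).
assert (H5 := Dlat_neq0 E (y / qh E ^ 2) Hq Hy').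
replace (y / qh E ^ 2 * qh E ^ 2) with y in H5 by (field; auto).
specialize (H5 H2).
transitivity ((bq E * lat E y) * ((lat E (y * qh E) - lat E (y / qh E)) * N (lat E y))
  + (Kq E - lat E y ^ 2) * ((lat E (y * qh E) - lat E (y / qh E)) * G (lat E y))
  + (lat E (y * qh E) - lat E (y / qh E)) * Rq E (lat E y) * F (lat E y)); [|ring].
rewrite <- H, <- H'.
set (Fp := F (lat E (y * qh E ^ 2))); set (F0 := F (lat E y));
  set (Fm := F (lat E (y / qh E ^ 2))).
assert (H6 : c1 E * y ^ 2 - c2 E * qh E ^ 2 <> 0).
{ intros Z; apply H5.
  transitivity ((c1 E * y ^ 2 - c2 E * qh E ^ 2) / qh E ^ 2).
  - field; auto.
  - rewrite Z; unfold Cdiv; ring. }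
assert (H7 := Cmult_neq_0 _ _ H3 H4); assert (H8 := Cmult_neq_0 _ _ H3 H6).
unfold Rq, r2, r1, r0, Kq, bq, they, sigy, e0, e1, e2, g1, g2, tt0, st1, st0, lat, kq.
field; nonzero.
Qed.

Lemma Drel_1 (E : equation) : Drel E (fun _ => 1) (fun _ => 0).
Proof. intros s Hs y; unfold Cdiv; ring. Qed.

Lemma Drel_X (E : equation) : qparam E ->
  Drel E (fun z => z) (fun z => ttilde1 E * z + tt0 E).
Proof.
intros Hq s Hs y.
destruct (generic_lat E s Hq Hs) as (H1 & H2 & _); fold y in H1, H2.
assert (Hy : y <> 0) by apply qpow_neq0.
assert (H3 := qh_sq_sub1 E Hq); assert (H0 := qh_neq0 E).
transitivity (they E y - sigy E y); [field; auto|].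
unfold they, sigy, e0, e1, e2, g1, g2, tt0, st1, st0, lat, kq.
field; nonzero.
Qed.

(* The two leading coefficients of D z^m, at M = q^(m/2). *)
Definition lc (E : equation) (M : C) : C := - (brk E M * Lam E M).
Definition lc1 (E : equation) (M : C) : C :=
  brk E M * (e1 E * M / qh E + e2 E * qh E / M).

(** This and [lc1_rec] are the coefficients of z^(m+2) and z^(m+1) in [Drel_mulX2] applied to F =
    z^m, with M = q^(m/2). The term with [Kq] has degree at most m and does not contribute. *)
Lemma lc_rec (E : equation) (M : C) : qparam E -> M <> 0 ->
  lc E (M * qh E ^ 2) = bq E * lc E (M * qh E) - lc E M + r2 E.
Proof.
intros Hq HM; assert (H3 := qh_sq_sub1 E Hq); assert (H0 := qh_neq0 E).
unfold lc, brk, Lam, bq, r2, g1, g2, kq, bq; field; nonzero.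
Qed.

Lemma lc1_rec (E : equation) (M : C) : qparam E -> M <> 0 ->
  lc1 E (M * qh E ^ 2) = bq E * lc1 E (M * qh E) - lc1 E M + r1 E.
Proof.
intros Hq HM; assert (H3 := qh_sq_sub1 E Hq); assert (H0 := qh_neq0 E).
unfold lc1, brk, bq, r1, e1, e2, kq, bq; field; nonzero.
Qed.

Lemma brk_1 (E : equation) : qparam E -> brk E 1 = 0.
Proof. intros Hq; assert (Hk := kq_neq0 E Hq); unfold brk; field; auto. Qed.

Definition D_pow_leading (E : equation) (n : nat) : Prop := exists low, deg_lt n low /\
  Drel E (fun z => z ^ S n)
    (fun z => lc E (qh E ^ S n) * z ^ S n + lc1 E (qh E ^ S n) * z ^ n + low z).

(** [Drel_mulX2] expresses D z^(m+2) through D z^m and D z^(m+1), so the induction carries two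
    consecutive exponents. *)
Lemma D_pow (E : equation) (n : nat) : qparam E -> D_pow_leading E n.
Proof.
intros Hq; assert (H3 := qh_sq_sub1 E Hq); assert (H0 := qh_neq0 E).
enough (D_pow_leading E n /\ D_pow_leading E (S n)) by tauto.
induction n as [|n [(l1 & Hl1 & H1) (l2 & Hl2 & H2)]]; split.
- exists (fun _ => 0); split; [apply deg_lt_zero|].
  apply Drel_ext with (3 := Drel_X E Hq).
  + intros z; simpl; ring.
  + intros z; simpl; unfold lc, lc1, brk, Lam, e1, e2, g1, g2, kq; field; nonzero.
- exists (fun _ => r0 E); split; [apply deg_lt_const|].
  assert (HX : Drel E (fun z => z * 1) (fun z => ttilde1 E * z + tt0 E)).
  { apply Drel_ext with (3 := Drel_X E Hq); intros z; ring. }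
  apply Drel_ext with (3 := Drel_mulX2 E _ _ _ Hq (Drel_1 E) HX).
  + intros z; simpl; ring.
  + intros z; replace (qh E ^ 2) with (1 * qh E ^ 2) by ring.
    assert (H1 : RtoC 1 <> 0) by (apply RtoC_neq0; lra).
    rewrite lc_rec, lc1_rec by trivial.
    unfold lc at 2, lc1 at 2; rewrite brk_1 by trivial.
    unfold Rq, lc, lc1, brk, Lam, e1, e2, g1, g2, kq; field; nonzero.
- exists l2; now split.
- exists (fun z => bq E * (z * l2 z) + (-(1)) * (z * (z * l1 z))
    + (Kq E * (lc E (qh E ^ S n) * z ^ S n)
    + Kq E * (lc1 E (qh E ^ S n) * z ^ n) + Kq E * l1 z) + r0 E * z ^ S n).
  split.
  + repeat apply deg_lt_plus; repeat apply deg_lt_scal.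
    * now apply deg_lt_mulX.
    * now apply deg_lt_mulX, deg_lt_mulX.
    * apply deg_lt_pow.
    * apply deg_lt_weaken with (S n); [lia | apply deg_lt_pow].
    * apply deg_lt_weaken with n; [lia | trivial].
    * apply deg_lt_pow.
  + apply Drel_ext with (3 := Drel_mulX2 E _ _ _ Hq H1 H2).
    * intros z; simpl; ring.
    * intros z; assert (HM := qhn_neq0 E (S n)).
      replace (qh E ^ S (S (S n))) with (qh E ^ S n * qh E ^ 2) by (simpl; ring).
      rewrite lc_rec, lc1_rec by trivial.
      replace (qh E ^ S (S n)) with (qh E ^ S n * qh E) by (simpl; ring).
      unfold Rq; simpl; ring.
Qed.

Lemma D_pow_top (E : equation) (n : nat) : qparam E -> exists low, deg_lt n low /\
  Drel E (fun z => z ^ n) (fun z => lc E (qh E ^ n) * z ^ n + low z).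
Proof.
intros Hq; destruct n as [|n].
- exists (fun _ => 0); split; [apply deg_lt_zero|].
  apply Drel_ext with (3 := Drel_1 E); intros z; [reflexivity|].
  unfold lc; simpl; rewrite brk_1 by trivial; ring.
- destruct (D_pow E n Hq) as (low & Hl & H).
  exists (fun z => lc1 E (qh E ^ S n) * z ^ n + low z); split.
  + apply deg_lt_plus; [apply deg_lt_scal, deg_lt_pow|].
    apply deg_lt_weaken with n; trivial; lia.
  + apply Drel_ext with (3 := H); intros z; [reflexivity | ring].
Qed.

Lemma D_deg_lt (E : equation) (d : nat) (F : C -> C) : qparam E -> deg_lt d F ->
  exists G, deg_lt d G /\ Drel E F G.
Proof.
intros Hq; revert F; induction d as [|d IH]; intros F HF.
- exists (fun _ => 0); split; [apply deg_lt_zero|].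
  destruct HF as ([|a l] & Hl & HF); [|discriminate].
  intros s Hs y; rewrite !HF; simpl; unfold Cdiv; ring.
- destruct (deg_lt_S d F HF) as (a & F' & HF' & HE).
  destruct (IH F' HF') as (G' & HG' & HD).
  destruct (D_pow_top E d Hq) as (low & Hl & HD').
  exists (fun z => a * (lc E (qh E ^ d) * z ^ d + low z) + 1 * G' z); split.
  + apply deg_lt_plus; apply deg_lt_scal.
    * apply deg_lt_plus; [apply deg_lt_scal, deg_lt_pow|].
      apply deg_lt_weaken with d; trivial; lia.
    * apply deg_lt_weaken with d; trivial; lia.
  + apply Drel_ext with (3 := Drel_lin E a 1 _ _ _ _ Hq HD' HD).
    * intros z; rewrite HE; ring.
    * reflexivity.
Qed.

Lemma Drel_unique (E : equation) (F G G' : C -> C) :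
  qparam E -> c1 E <> 0 \/ c2 E <> 0 -> ispoly G -> ispoly G' ->
  Drel E F G -> Drel E F G' -> forall z, G z = G' z.
Proof.
intros Hq Hc HG HG' H H' z; apply Ceq_minus.
apply (poly_zero_on_lattice E (fun z => G z - G' z)); trivial; [ispoly_tac|].
intros s Hs; destruct (generic_lat E s Hq Hs) as (_ & _ & H3).
specialize (H s Hs); specialize (H' s Hs); cbv zeta in *; rewrite H in H'.
unfold zs; apply -> Ceq_minus.
set (D := lat E (qpow (q E) s * qh E) - lat E (qpow (q E) s / qh E)) in *.
transitivity (D * G (lat E (qpow (q E) s)) / D); [field; trivial|].
rewrite H'; field; trivial.
Qed.

(** * The eigenpolynomials and their two leading coefficients *)

Definition Pz (E : equation) (W : system) (n : nat) (z : C) : C := P W n (z + c3 E).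

Lemma Px_Pz (E : equation) (W : system) (n : nat) (s : C) :
  Px E W n s = Pz E W n (zs E s).
Proof. unfold Px, Pz, zs; now rewrite xE. Qed.

Lemma deg_lt_shift_pow (n : nat) (c : C) :
  exists low, deg_lt n low /\ forall z, (z + c) ^ n = z ^ n + low z.
Proof.
induction n as [|n (low & Hl & IH)].
- exists (fun _ => 0); split; [apply deg_lt_zero|]; intros z; simpl; ring.
- exists (fun z => c * z ^ n + (z * low z + c * low z)); split.
  + apply deg_lt_plus; [apply deg_lt_scal, deg_lt_pow|].
    apply deg_lt_plus; [now apply deg_lt_mulX|].
    apply deg_lt_scal, deg_lt_weaken with n; trivial; lia.
  + intros z; simpl; rewrite IH; ring.
Qed.

Lemma Pz_top (E : equation) (W : system) (n : nat) : exists low, deg_lt n low /\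
  forall z, Pz E W n z = lead W n * z ^ n + low z.
Proof.
unfold Pz, P, lead; generalize (coef W); intros a.
enough (H : forall m, exists low, deg_lt m low /\ forall z,
  sum_n (G := C_AbelianMonoid) (fun k => a n k * (z + c3 E) ^ k) m
  = a n m * z ^ m + low z) by apply H.
induction m as [|m (low & Hl & IH)].
- exists (fun _ => 0); split; [apply deg_lt_zero|]; intros z.
  rewrite sum_O; simpl; ring.
- destruct (deg_lt_shift_pow (S m) (c3 E)) as (low' & Hl' & H').
  exists (fun z => a n (S m) * low' z + (a n m * z ^ m + low z)); split.
  + apply deg_lt_plus; [now apply deg_lt_scal|].
    apply deg_lt_plus; [apply deg_lt_scal, deg_lt_pow|].
    apply deg_lt_weaken with m; trivial; lia.
  + intros z; rewrite sum_Sn, IH, H'.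
    change (a n m * z ^ m + low z + a n (S m) * (z ^ S m + low' z)
      = a n (S m) * z ^ S m + (a n (S m) * low' z + (a n m * z ^ m + low z))).
    ring.
Qed.

Lemma Pz_deg_lt (E : equation) (W : system) (n : nat) : deg_lt (S n) (Pz E W n).
Proof.
destruct (Pz_top E W n) as (low & Hl & H).
apply deg_lt_ext with (fun z => lead W n * z ^ n + low z); [intros z; now rewrite H|].
apply deg_lt_plus; [apply deg_lt_scal, deg_lt_pow|].
apply deg_lt_weaken with n; trivial; lia.
Qed.

Lemma Drel_Pz (E : equation) (W : system) (n : nat) :
  standing E W -> in_family (supp W) n ->
  Drel E (Pz E W n) (fun z => - lambda E n * Pz E W n z).
Proof.
intros H Hn s (H1 & H2 & H3) y; assert (Hq := standing_qparam E W H).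
assert (H4 := difference_equation E W n s H Hn H1 H2).
unfold Delta at 1, Nabla at 1 in H4.
rewrite !Px_Pz, ThetaE, sigmaE, DxE, NxE, DxmidE in H4 by trivial.
unfold zs in H4; rewrite qpow_add1, qpow_sub1 in H4 by trivial; fold y in H4.
apply Ceq_minus; rewrite <- H4; ring.
Qed.

(** Since [lc] is -lambda, this says lambda_n - lambda_(n+1) = tau_n': consecutive eigenvalues
    always differ. *)
Lemma lc_diff (E : equation) (M : C) : qparam E -> M <> 0 ->
  lc E (M * qh E) - lc E M = tp E M.
Proof.
intros Hq HM; assert (H3 := qh_sq_sub1 E Hq); assert (H0 := qh_neq0 E).
unfold lc, brk, Lam, tp, g1, g2, kq; field; nonzero.
Qed.

(** Comparing the coefficients of z^n in D P_(n+1) = -lambda_(n+1) P_(n+1) gives a linear equation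
    for the second coefficient f, in which f is multiplied by tau_n'. *)
Lemma Pz_top2 (E : equation) (W : system) (n : nat) :
  standing E W -> in_family (supp W) (S n) -> exists low, deg_lt n low /\
  forall z, Pz E W (S n) z = lead W (S n)
    * (z ^ S n + brk E (qh E ^ n * qh E) * off E (qh E ^ n) * z ^ n) + low z.
Proof.
intros H Hn; assert (Hq := standing_qparam E W H).
assert (Hn' : in_family (supp W) n) by (apply in_family_le with (S n); auto).
assert (Ht := tau_n'_neq0 E W H n Hn'); rewrite tau_n'E in Ht by trivial.
assert (HM := qhn_neq0 E n); assert (H0 := qh_neq0 E).
destruct (Pz_top E W (S n)) as (low & Hl & HP).
destruct (deg_lt_S n low Hl) as (f & low' & Hl' & Hf).
exists low'; split; trivial; intros z; rewrite HP, Hf.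
enough (Hfa : f = lead W (S n) * (brk E (qh E ^ n * qh E) * off E (qh E ^ n)))
  by (rewrite Hfa; ring).
clear z.
destruct (D_pow E n Hq) as (l1 & Hl1 & HD1).
destruct (D_pow_top E n Hq) as (l2 & Hl2 & HD2).
destruct (D_deg_lt E n low' Hq Hl') as (l3 & Hl3 & HD3).
set (a := lead W (S n)) in *.
assert (HD := Drel_lin E 1 1 _ _ _ _ Hq
  (Drel_lin E a f _ _ _ _ Hq HD1 HD2) HD3).
assert (HD' := Drel_Pz E W (S n) H Hn).
apply (Drel_ext E _ (Pz E W (S n))) with (2 := fun z => eq_refl) in HD;
  [|intros z; rewrite HP, Hf; ring].
assert (Hu := fun hG hG' => Drel_unique E _ _ _ Hq (lattice_nonconstant E W H)
  hG hG' HD HD').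
cbv beta in Hu.
assert (HG : ispoly (fun z => - lambda E (S n) * Pz E W (S n) z)).
{ exists (S (S n)); apply deg_lt_scal, Pz_deg_lt. }
assert (Hp1 : forall m, ispoly (fun z => z ^ m)) by (intros m; exists (S m); apply deg_lt_pow).
assert (Hp2 : ispoly l1) by (now exists n).
assert (Hp3 : ispoly l2) by (now exists n).
assert (Hp4 : ispoly l3) by (now exists n).
specialize (Hu ltac:(ispoly_tac; apply Hp1) HG).
rewrite lambdaE in Hu by trivial; fold (lc E (qh E ^ S n)) in Hu.
assert (Hz : a * lc1 E (qh E ^ S n) + f * lc E (qh E ^ n) - lc E (qh E ^ S n) * f = 0).
{ apply (top_coefs_zero n 0 _
    (fun z => (a * l1 z + f * l2 z) + (l3 z + - lc E (qh E ^ S n) * low' z))).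
  - repeat apply deg_lt_plus; repeat apply deg_lt_scal; trivial.
  - intros z; specialize (Hu z); rewrite HP, Hf in Hu.
    apply Ceq_minus in Hu.
    etransitivity; [|exact Hu]; ring. }
replace (qh E ^ S n) with (qh E ^ n * qh E) in Hz by (simpl; ring).
assert (Hd := lc_diff E (qh E ^ n) Hq HM).
transitivity (f * tp E (qh E ^ n) / tp E (qh E ^ n)); [field; trivial|].
rewrite <- Hd at 1.
replace (f * (lc E (qh E ^ n * qh E) - lc E (qh E ^ n)))
  with (a * lc1 E (qh E ^ n * qh E)).
- unfold lc1, off; field; auto.
- apply Ceq_minus; rewrite <- Hz; ring.
Qed.

(** * Sums and contour integrals *)

#[local] Instance from_above_filter (l : Rbar) : ProperFilter (from_above l).
Proof. destruct l; unfold from_above; apply _. Qed.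

#[local] Instance from_below_filter (l : Rbar) : ProperFilter (from_below l).
Proof. destruct l; unfold from_below; apply _. Qed.

Lemma from_above_in_param (G : contour) : Rbar_lt (clo G) (chi G) ->
  from_above (clo G) (in_param G).
Proof.
unfold in_param; destruct (clo G) as [r| |], (chi G) as [r'| |]; simpl;
  intros H; try tauto.
- apply (filter_imp (F := locally r) (fun t => t < r')%R);
    [intros t Ht Hr; tauto | exact (open_lt r' r H)].
- exists (mkposreal 1 Rlt_0_1); intros t _ Ht; tauto.
- exists r'; intros t Ht; tauto.
- exists 0%R; intros t Ht; tauto.
Qed.

Lemma from_below_in_param (G : contour) : Rbar_lt (clo G) (chi G) ->
  from_below (chi G) (in_param G).
Proof.
unfold in_param; destruct (clo G) as [r| |], (chi G) as [r'| |]; simpl;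
  intros H; try tauto.
- apply (filter_imp (F := locally r') (fun t => r < t)%R);
    [intros t Ht Hr; tauto | exact (open_gt r r' H)].
- exists r; intros t Ht; tauto.
- exists (mkposreal 1 Rlt_0_1); intros t _ Ht; tauto.
- exists 0%R; intros t Ht; tauto.
Qed.

(** Membership of 0 in the family excludes N = 0, where the sum up to [pred N] would still read one
    node. Agreement is asked only where both s and s + 1 lie in [dom], which is where the Pearson
    equation is available. *)
Lemma total_ext (W : system) (g h : C -> C) (l : C) :
  in_family (supp W) 0 -> support_in (supp W) (dom W) ->
  (forall s, dom W s -> dom W (s + 1) -> g s = h s) ->
  total (supp W) g l -> total (supp W) h l.
Proof.
intros Hf Hs H.
assert (Hnode : forall a j, node a j + 1 = node a (S j)).
{ intros a j; unfold node; rewrite S_INR, RtoC_plus; ring. }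
destruct (supp W) as [a N|a|G]; simpl in *.
- intros <-; apply sum_n_ext_loc; intros j Hj; symmetry; apply H;
    [|rewrite Hnode]; apply Hs; lia.
- apply is_series_ext; intros j; apply H; [|rewrite Hnode]; apply Hs.
- destruct Hs as [(Hlt & _) Hs]; intros [H1 H2].
  assert (Hin : filter_prod (from_above (clo G)) (from_below (chi G))
    (fun ab => forall t, (Rmin (fst ab) (snd ab) < t < Rmax (fst ab) (snd ab))%R ->
       g (cpath G t) * cspeed G t = h (cpath G t) * cspeed G t)).
  { apply Filter_prod with (in_param G) (in_param G).
    - now apply from_above_in_param.
    - now apply from_below_in_param.
    - intros a b (Ha1 & Ha2) (Hb1 & Hb2) t [Ht1 Ht2]; simpl in *.
      assert (Ht : in_param G t).
      { split.
        - destruct (clo G); simpl in *; trivial;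
            unfold Rmin in Ht1; destruct (Rle_dec a b); lra.
        - destruct (chi G); simpl in *; trivial;
            unfold Rmax in Ht2; destruct (Rle_dec a b); lra. }
      now rewrite H by now apply Hs. }
  split; [revert H1 | revert H2]; apply is_RInt_gen_ext;
    revert Hin; apply filter_imp; intros ab Hab t Ht; now rewrite (Hab t Ht).
Qed.

Lemma is_RInt_gen_eq (Fa Fb : (R -> Prop) -> Prop) {FFa : Filter Fa} {FFb : Filter Fb}
  (f g : R -> R) (l m : R) : (forall t, f t = g t) -> l = m ->
  is_RInt_gen (V := R_NormedModule) f Fa Fb l ->
  is_RInt_gen (V := R_NormedModule) g Fa Fb m.
Proof.
intros H <-; apply is_RInt_gen_ext; apply filter_forall; intros ab t _; apply H.
Qed.

Lemma total_plus (Sp : support) (g h : C -> C) (l m : C) :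
  total Sp g l -> total Sp h m -> total Sp (fun s => g s + h s) (l + m).
Proof.
destruct Sp as [a N|a|G]; simpl.
- intros <- <-; apply (sum_n_plus (G := C_AbelianMonoid)).
- apply (is_series_plus (V := C_NormedModule)).
- intros [H1 H2] [H3 H4]; split.
  + refine (is_RInt_gen_eq _ _ _ _ _ _ _ _ (is_RInt_gen_plus _ _ _ _ H1 H3));
      [intros t; simpl; unfold plus; simpl; ring | reflexivity].
  + refine (is_RInt_gen_eq _ _ _ _ _ _ _ _ (is_RInt_gen_plus _ _ _ _ H2 H4));
      [intros t; simpl; unfold plus; simpl; ring | reflexivity].
Qed.

Lemma total_scal (Sp : support) (c : C) (g : C -> C) (l : C) :
  total Sp g l -> total Sp (fun s => c * g s) (c * l).
Proof.
destruct Sp as [a N|a|G]; simpl.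
- intros <-; apply (sum_n_mult_l (K := C_Ring)).
- apply (is_series_scal (V := C_NormedModule) c).
- intros [H1 H2]; split.
  + refine (is_RInt_gen_eq _ _ _ _ _ _ _ _ (is_RInt_gen_minus _ _ _ _
      (is_RInt_gen_scal _ (Re c) _ H1) (is_RInt_gen_scal _ (Im c) _ H2)));
      [intros t|]; simpl; unfold minus, plus, opp, scal; simpl; unfold mult, Re, Im; simpl; ring.
  + refine (is_RInt_gen_eq _ _ _ _ _ _ _ _ (is_RInt_gen_plus _ _ _ _
      (is_RInt_gen_scal _ (Re c) _ H2) (is_RInt_gen_scal _ (Im c) _ H1)));
      [intros t|]; simpl; unfold plus, scal; simpl; unfold mult, Re, Im; simpl; ring.
Qed.

Lemma total_unique (Sp : support) (g : C -> C) (l m : C) :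
  total Sp g l -> total Sp g m -> l = m.
Proof.
destruct Sp as [a N|a|G]; simpl.
- now intros <- <-.
- apply (filterlim_locally_unique (V := C_NormedModule)).
- intros [H1 H2] [H3 H4]; apply injective_projections.
  + transitivity (RInt_gen (V := R_CompleteNormedModule)
      (fun t => Re (g (cpath G t) * cspeed G t)) (from_above (clo G)) (from_below (chi G)));
      [symmetry|]; now apply is_RInt_gen_unique.
  + transitivity (RInt_gen (V := R_CompleteNormedModule)
      (fun t => Im (g (cpath G t) * cspeed G t)) (from_above (clo G)) (from_below (chi G)));
      [symmetry|]; now apply is_RInt_gen_unique.
Qed.

(** * Exact differences and selfadjointness *)

Definition boundary_weight (E : equation) (W : system) (T : C -> C) (s : C) : C :=
  sigma E s * rho W s * T (x E (s - half)).

Lemma total_Delta_pow (E : equation) (W : system) (k : nat) :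
  standing E W -> in_family (supp W) 0 ->
  total (supp W) (Delta (boundary_weight E W (fun z => z ^ k))) 0.
Proof.
intros H Hf; assert (Hb := supp_boundary E W H).
assert (Htel : forall w a n,
  sum_n (G := C_AbelianMonoid) (fun j => Delta w (node a j)) n
  = w (node a (S n)) - w a).
{ intros w a n.
  assert (Hnode : forall j, node a j + 1 = node a (S j)).
  { intros j; unfold node; rewrite S_INR, RtoC_plus; ring. }
  assert (H0 : node a 0 = a) by (unfold node; simpl; ring).
  induction n as [|n IH].
  - rewrite sum_O; unfold Delta; now rewrite Hnode, H0.
  - rewrite sum_Sn, IH.
    change (w (node a (S n)) - w a + Delta w (node a (S n)) = w (node a (S (S n))) - w a).
    unfold Delta; rewrite Hnode; ring. }
unfold boundary in Hb; destruct (supp W) as [a N|a|G]; simpl in *.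
- rewrite Htel; replace (S (pred N)) with N by lia.
  destruct Hb as [_ Hb]; destruct (Hb k) as [H1 H2].
  unfold boundary_weight; rewrite H1, H2; ring.
- destruct Hb as [_ Hb]; destruct (Hb k) as [H1 H2].
  unfold is_series.
  apply (filterlim_ext (fun n => boundary_weight E W (fun z => z ^ k) (node a (S n)))).
  + intros n; rewrite Htel; unfold boundary_weight at 3; rewrite H1; ring.
  + apply (filterlim_comp _ _ _ S (fun n => boundary_weight E W (fun z => z ^ k) (node a n))
      eventually eventually); [|exact H2].
    apply eventually_subseq; intros n; lia.
- apply Hb.
Qed.

Lemma total_Delta_poly (E : equation) (W : system) (T : C -> C) :
  standing E W -> in_family (supp W) 0 -> ispoly T ->
  total (supp W) (Delta (boundary_weight E W T)) 0.
Proof.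
intros H Hf (d & l & _ & HT).
(* Each Horner step moves a factor z out of the remaining list, so the induction needs an arbitrary
   power in front. *)
enough (Hk : forall k, total (supp W)
  (Delta (boundary_weight E W (fun z => z ^ k * ev l z))) 0).
{ apply (total_ext W) with (4 := Hk 0%nat); trivial; [apply (supp_dom E W H)|].
  intros s _ _; unfold Delta, boundary_weight; rewrite !HT; simpl; ring. }
clear T HT; induction l as [|a l IH]; intros k.
- replace (RtoC 0) with (0 * 0) by ring.
  apply (total_ext W) with (4 := total_scal _ 0 _ _ (total_Delta_pow E W k H Hf));
    trivial; [apply (supp_dom E W H)|].
  intros s _ _; unfold Delta, boundary_weight; simpl; ring.
- replace (RtoC 0) with (a * 0 + 0) by ring.
  apply (total_ext W) with (4 := total_plus _ _ _ _ _
    (total_scal _ a _ _ (total_Delta_pow E W k H Hf)) (IH (S k)));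
    trivial; [apply (supp_dom E W H)|].
  intros s _ _; unfold Delta, boundary_weight; simpl; ring.
Qed.

(* A relation rather than a function, as the series or integral need not converge for every F. *)
Definition pair (E : equation) (W : system) (F : C -> C) (l : C) : Prop :=
  total (supp W) (fun s => F (zs E s) * rho W s * Dxmid E s) l.

Lemma ispoly_shift (F : C -> C) (c : C) : ispoly F -> ispoly (fun z => F (z + c)).
Proof.
intros (d & l & _ & HF).
apply ispoly_ext with (fun z => ev l (z + c)); [intros z; now rewrite HF|].
clear HF; induction l as [|a l IH]; simpl; ispoly_tac.
Qed.

(* Two neighbouring lattice values are the conjugate roots mean +- delta, with mean
   and delta^2 polynomial in the lattice value at the midpoint. *)
Lemma conjugate_decomposition (E : equation) (T : C -> C) : ispoly T ->
  exists A B, ispoly A /\ ispoly B /\ forall y : C, y <> 0 ->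
  let d := (lat E (y * qh E) - lat E (y / qh E)) / 2 in
  T (lat E (y * qh E)) = A (lat E y) + B (lat E y) * d /\
  T (lat E (y / qh E)) = A (lat E y) - B (lat E y) * d.
Proof.
assert (H0 := qh_neq0 E).
intros (n & l & _ & HT).
enough (Hl : exists A B, ispoly A /\ ispoly B /\ forall y : C, y <> 0 ->
  let d := (lat E (y * qh E) - lat E (y / qh E)) / 2 in
  ev l (lat E (y * qh E)) = A (lat E y) + B (lat E y) * d /\
  ev l (lat E (y / qh E)) = A (lat E y) - B (lat E y) * d).
{ destruct Hl as (A & B & HA & HB & Hl); exists A, B; split; [|split]; trivial.
  intros y Hy; rewrite !HT; now apply Hl. }
clear HT; induction l as [|a l (A & B & HA & HB & IH)].
- exists (fun _ => 0), (fun _ => 0); split; [|split]; try apply ispoly_const.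
  intros y Hy d; simpl; split; ring.
- set (m := (qh E + / qh E) / 2).
  set (D := fun z : C => (qh E - / qh E) * (qh E - / qh E) / 4
                     * (z * z - 4 * (c1 E * c2 E))).
  exists (fun z => a + (m * z * A z + D z * B z)), (fun z => m * z * B z + A z).
  split; [|split]; unfold D; ispoly_tac.
  intros y Hy; destruct (IH y Hy) as [H1 H2]; cbv zeta in *.
  set (d := (lat E (y * qh E) - lat E (y / qh E)) / 2) in *.
  assert (Hp : lat E (y * qh E) = m * lat E y + d)
    by (unfold m, d, lat; field; auto).
  assert (Hm : lat E (y / qh E) = m * lat E y - d)
    by (unfold m, d, lat; field; auto).
  assert (Hd : (qh E - / qh E) * (qh E - / qh E) / 4
    * (lat E y * lat E y - 4 * (c1 E * c2 E)) = d * d)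
    by (unfold d, lat; field; auto).
  simpl ev; rewrite H1, H2, Hp, Hm, Hd; split; ring.
Qed.

(** A discrete Lagrange identity. The Casoratian F1(s) F2(s+1) - F2(s) F1(s+1) divided by Delta x(s)
    is a polynomial T in the midpoint value, by [conjugate_decomposition]. The Pearson equation
    turns the weighted expression Theta(s) T(s+1/2) - sigma(s) T(s-1/2) into the difference of a
    [boundary_weight], whose total is 0. A second decomposition extracts the factor [Dxmid] and
    leaves a polynomial V. It equals F1 G2 - F2 G1 at generic points, hence everywhere, so no
    support point has to be generic. *)
Lemma selfadjoint (E : equation) (W : system) (F1 G1 F2 G2 : C -> C) :
  standing E W -> in_family (supp W) 0 ->
  ispoly F1 -> ispoly G1 -> ispoly F2 -> ispoly G2 ->
  Drel E F1 G1 -> Drel E F2 G2 ->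
  pair E W (fun z => F1 z * G2 z - F2 z * G1 z) 0.
Proof.
intros H Hf HF1 HG1 HF2 HG2 HD1 HD2.
assert (Hq := standing_qparam E W H); assert (H0 := qh_neq0 E).
destruct (conjugate_decomposition E F1 HF1) as (A1 & B1 & HA1 & HB1 & HE1).
destruct (conjugate_decomposition E F2 HF2) as (A2 & B2 & HA2 & HB2 & HE2).
set (T := fun z => A1 z * B2 z - A2 z * B1 z).
assert (HT : ispoly T) by (unfold T; ispoly_tac).
destruct (conjugate_decomposition E T HT) as (A & B & HA & HB & HE).
set (st := fun z => stilde2 E / 2 * (z * z) + st1 E * z + st0 E).
set (V := fun z => st z * B z + (ttilde1 E * z + tt0 E) * A z).
assert (HV : ispoly V) by (unfold V, st; ispoly_tac).
assert (HTV : forall y : C, y <> 0 ->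
  they E y * T (lat E (y * qh E)) - sigy E y * T (lat E (y / qh E))
  = (lat E (y * qh E) - lat E (y / qh E)) * V (lat E y)).
{ intros y Hy; destruct (HE y Hy) as [-> ->].
  assert (H3 := qh_sq_sub1 E Hq).
  assert (Hs : sigy E y = st (lat E y) - (ttilde1 E * lat E y + tt0 E)
    * ((lat E (y * qh E) - lat E (y / qh E)) / 2)).
  { unfold st, sigy, e0, e1, e2, g1, g2, tt0, st1, st0, lat, kq; field; nonzero. }
  assert (Ht : they E y = st (lat E y) + (ttilde1 E * lat E y + tt0 E)
    * ((lat E (y * qh E) - lat E (y / qh E)) / 2)).
  { unfold st, they, e0, e1, e2, g1, g2, tt0, st1, st0, lat, kq; field; nonzero. }
  rewrite Hs, Ht; unfold V; field. }
assert (HGV : forall z, F1 z * G2 z - F2 z * G1 z = V z).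
{ intros z; apply Ceq_minus.
  apply (poly_zero_on_lattice E (fun z => F1 z * G2 z - F2 z * G1 z - V z));
    [trivial | apply (lattice_nonconstant E W H) | ispoly_tac |].
  intros s Hs; destruct (generic_lat E s Hq Hs) as (Hn1 & Hn2 & Hn3).
  specialize (HD1 s Hs); specialize (HD2 s Hs); cbv zeta in *; unfold zs.
  set (y := qpow (q E) s) in *.
  assert (Hy : y <> 0) by apply qpow_neq0.
  destruct (HE1 (y * qh E)) as [Ha Hb]; [now apply Cmult_neq_0|].
  destruct (HE2 (y * qh E)) as [Hc Hd]; [now apply Cmult_neq_0|].
  destruct (HE1 (y / qh E)) as [Ha' Hb']; [now apply Cdiv_neq0|].
  destruct (HE2 (y / qh E)) as [Hc' Hd']; [now apply Cdiv_neq0|].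
  replace (y * qh E * qh E) with (y * qh E ^ 2) in * by ring.
  replace (y * qh E / qh E) with y in * by (field; auto).
  replace (y / qh E * qh E) with y in * by (field; auto).
  replace (y / qh E / qh E) with (y / qh E ^ 2) in * by (field; auto).
  set (D := lat E (y * qh E) - lat E (y / qh E)) in *.
  enough (HDD : D * (F1 (lat E y) * G2 (lat E y) - F2 (lat E y) * G1 (lat E y))
    = D * V (lat E y)).
  { apply -> Ceq_minus.
    transitivity (D * (F1 (lat E y) * G2 (lat E y) - F2 (lat E y) * G1 (lat E y)) / D);
      [field; trivial|].
    rewrite HDD; field; trivial. }
  unfold D at 2; rewrite <- HTV by trivial.
  transitivity (F1 (lat E y) * (D * G2 (lat E y)) - F2 (lat E y) * (D * G1 (lat E y)));
    [ring|].
  rewrite <- HD1, <- HD2.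
  set (dp := lat E (y * qh E ^ 2) - lat E y) in *.
  set (dm := lat E y - lat E (y / qh E ^ 2)) in *.
  assert (HTp : F1 (lat E y) * F2 (lat E (y * qh E ^ 2))
    - F2 (lat E y) * F1 (lat E (y * qh E ^ 2)) = dp * T (lat E (y * qh E))).
  { rewrite Ha, Hc, Hb, Hd; unfold T; field. }
  assert (HTm : F2 (lat E y) * F1 (lat E (y / qh E ^ 2))
    - F1 (lat E y) * F2 (lat E (y / qh E ^ 2)) = dm * T (lat E (y / qh E))).
  { rewrite Ha', Hc', Hb', Hd'; unfold T; field. }
  transitivity (they E y * ((F1 (lat E y) * F2 (lat E (y * qh E ^ 2))
    - F2 (lat E y) * F1 (lat E (y * qh E ^ 2))) / dp)
    - sigy E y * ((F2 (lat E y) * F1 (lat E (y / qh E ^ 2))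
    - F1 (lat E y) * F2 (lat E (y / qh E ^ 2))) / dm)); [field; auto|].
  rewrite HTp, HTm; field; auto. }
apply (total_ext W) with (4 := total_Delta_poly E W _ H Hf (ispoly_shift T (- c3 E) HT));
  trivial; [apply (supp_dom E W H)|].
intros s Hs Hs1; rewrite HGV, DxmidE by trivial.
assert (Hy := qpow_neq0 (q E) s).
transitivity (rho W s * ((lat E (qpow (q E) s * qh E) - lat E (qpow (q E) s / qh E))
  * V (lat E (qpow (q E) s)))); [|unfold zs; ring].
rewrite <- HTV by trivial.
assert (Hp := pearson_Theta E W s H Hs Hs1).
unfold Delta, boundary_weight; rewrite Hp, ThetaE, sigmaE, !xE by trivial.
rewrite !qpow_sub_half, qpow_add1 by trivial.
replace (qpow (q E) s * qh E ^ 2 / qh E) with (qpow (q E) s * qh E) by (field; auto).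
replace (lat E (qpow (q E) s * qh E) + c3 E + - c3 E)
  with (lat E (qpow (q E) s * qh E)) by ring.
replace (lat E (qpow (q E) s / qh E) + c3 E + - c3 E)
  with (lat E (qpow (q E) s / qh E)) by ring.
ring.
Qed.

(** * Norms and the three-term recurrence *)

Lemma pair_ext (E : equation) (W : system) (F G : C -> C) (l : C) :
  (forall z, F z = G z) -> pair E W F l -> pair E W G l.
Proof. intros H; now rewrite (functional_extensionality F G H). Qed.

Lemma pair_lin (E : equation) (W : system) (a b : C) (F G : C -> C) (l m : C) :
  pair E W F l -> pair E W G m ->
  pair E W (fun z => a * F z + b * G z) (a * l + b * m).
Proof.
intros H1 H2; unfold pair.
replace (fun s => (a * F (zs E s) + b * G (zs E s)) * rho W s * Dxmid E s)
  with (fun s => a * (F (zs E s) * rho W s * Dxmid E s)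
                 + b * (G (zs E s) * rho W s * Dxmid E s))
  by (apply functional_extensionality; intros s; ring).
now apply total_plus; apply total_scal.
Qed.

Lemma pair_Pz (E : equation) (W : system) (n m : nat) :
  standing E W -> in_family (supp W) n -> in_family (supp W) m ->
  pair E W (fun z => Pz E W n z * Pz E W m z)
    (if Nat.eqb n m then dnorm W n ^ 2 else 0).
Proof.
intros H Hn Hm; assert (HP := P_orthogonal E W H n m Hn Hm); unfold pair.
replace (fun s => Pz E W n (zs E s) * Pz E W m (zs E s) * rho W s * Dxmid E s)
  with (fun s => Px E W n s * Px E W m s * rho W s * Dxmid E s); trivial.
apply functional_extensionality; intros s; now rewrite !Px_Pz.
Qed.

Lemma pair_Pz_neq (E : equation) (W : system) (n m : nat) :
  standing E W -> in_family (supp W) n -> in_family (supp W) m -> n <> m ->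
  pair E W (fun z => Pz E W n z * Pz E W m z) 0.
Proof.
intros H Hn Hm Hnm; assert (HP := pair_Pz E W n m H Hn Hm).
now rewrite (proj2 (Nat.eqb_neq n m) Hnm) in HP.
Qed.

Lemma pair_Pz_eq (E : equation) (W : system) (n : nat) :
  standing E W -> in_family (supp W) n ->
  pair E W (fun z => Pz E W n z * Pz E W n z) (dnorm W n ^ 2).
Proof.
intros H Hn; assert (HP := pair_Pz E W n n H Hn Hn).
now rewrite Nat.eqb_refl in HP.
Qed.

Lemma deg_lt_Pz_split (E : equation) (W : system) (d : nat) (F : C -> C) :
  standing E W -> in_family (supp W) d -> deg_lt (S d) F ->
  exists c G, deg_lt d G /\ forall z, F z = c * Pz E W d z + G z.
Proof.
intros H Hd HF; destruct (deg_lt_S d F HF) as (a & G & HG & HE).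
destruct (Pz_top E W d) as (low & Hl & HP).
assert (Hlead := lead_neq0 E W H d Hd).
exists (a / lead W d), (fun z => G z + (- (a / lead W d)) * low z); split.
- apply deg_lt_plus; [trivial | now apply deg_lt_scal].
- intros z; rewrite HE, HP; field; trivial.
Qed.

Lemma pair_Pz_deg_lt (E : equation) (W : system) (n d : nat) (F : C -> C) :
  standing E W -> in_family (supp W) n -> (d <= n)%nat -> deg_lt d F ->
  pair E W (fun z => Pz E W n z * F z) 0.
Proof.
intros H Hn; revert F; induction d as [|d IH]; intros F Hd HF.
- replace (RtoC 0) with (0 * dnorm W n ^ 2 + 0 * dnorm W n ^ 2) by ring.
  assert (HP := pair_Pz_eq E W n H Hn).
  refine (pair_ext _ _ _ _ _ _ (pair_lin _ _ 0 0 _ _ _ _ HP HP)).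
  destruct HF as ([|a l] & Hl & HF); [|discriminate].
  intros z; rewrite HF; simpl; ring.
- assert (Hd' : in_family (supp W) d) by (apply in_family_le with n; trivial; lia).
  destruct (deg_lt_Pz_split E W d F H Hd' HF) as (c & G & HG & HE).
  replace (RtoC 0) with (c * 0 + 1 * 0) by ring.
  refine (pair_ext _ _ _ _ _ _ (pair_lin _ _ c 1 _ _ _ _
    (pair_Pz_neq E W n d H Hn Hd' _) (IH G _ HG))); try lia.
  intros z; rewrite HE; ring.
Qed.

Lemma deg_lt_orthogonal_zero (E : equation) (W : system) (d : nat) (F : C -> C) :
  standing E W -> (forall k, (k < d)%nat -> in_family (supp W) k) -> deg_lt d F ->
  (forall k, (k < d)%nat -> pair E W (fun z => Pz E W k z * F z) 0) ->
  forall z, F z = 0.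
Proof.
intros H; revert F; induction d as [|d IH]; intros F Hf HF Ho.
- destruct HF as ([|a l] & Hl & HF); [|discriminate]; intros z; now rewrite HF.
- assert (Hd : in_family (supp W) d) by (apply Hf; lia).
  destruct (deg_lt_Pz_split E W d F H Hd HF) as (c & G & HG & HE).
  assert (Hn := dnorm_neq0 E W H d Hd).
  assert (Hc : c = 0).
  { assert (H1 := pair_lin _ _ c 1 _ _ _ _ (pair_Pz_eq E W d H Hd)
      (pair_Pz_deg_lt E W d d G H Hd (Nat.le_refl d) HG)).
    apply (pair_ext E W _ (fun z => Pz E W d z * F z)) in H1;
      [|intros z; rewrite HE; ring].
    assert (H2 := total_unique _ _ _ _ H1 (Ho d (Nat.lt_succ_diag_r d))).
    transitivity ((c * dnorm W d ^ 2 + 1 * 0) / dnorm W d ^ 2); [field; trivial|].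
    rewrite H2; unfold Cdiv; ring. }
  assert (HFG : forall z, F z = G z) by (intros z; rewrite HE, Hc; ring).
  apply IH; [intros k Hk; apply Hf; lia | |intros k Hk; apply Ho; lia].
  now apply deg_lt_ext with G.
Qed.

(* The coefficient of P_(n-1) in z P_n. *)
Definition gam (W : system) (n : nat) : C :=
  match n with
  | O => 0
  | S m => gammaS W m
  end.

(** By [Pz_top2] the coefficients alpha_n and beta_n cancel the powers z^(n+1) and z^n in the
    difference of the two sides. What remains has degree below n and is orthogonal to P_0, ...,
    P_(n-1), hence is 0. *)
Lemma recurrence (E : equation) (W : system) (n : nat) :
  standing E W -> in_family (supp W) (S n) -> forall z,
  z * Pz E W n z = alpha W n * Pz E W (S n) z
    + (bet E (qh E ^ n) * Pz E W n z + gam W n * Pz E W (pred n) z).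
Proof.
intros H Hn; assert (Hq := standing_qparam E W H).
assert (Hf : forall k, (k <= S n)%nat -> in_family (supp W) k)
  by (intros k Hk; now apply in_family_le with (S n)).
assert (H0 := qh_neq0 E).
assert (Ha := lead_neq0 E W H n (Hf n ltac:(lia))).
assert (Ha1 := lead_neq0 E W H (S n) Hn).
destruct (Pz_top2 E W n H Hn) as (low1 & Hl1 & HP1).
set (F := fun z => z * Pz E W n z - (alpha W n * Pz E W (S n) z
    + (bet E (qh E ^ n) * Pz E W n z + gam W n * Pz E W (pred n) z))).
enough (HF : forall z, F z = 0) by (intros z; apply Ceq_minus; exact (HF z)).
apply (deg_lt_orthogonal_zero E W n); trivial; [intros k Hk; apply Hf; lia | |].
- assert (Hdn : exists G, deg_lt n G /\ forall z, z * Pz E W n z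
    - (alpha W n * Pz E W (S n) z + bet E (qh E ^ n) * Pz E W n z) = G z).
  { destruct n as [|m].
    - destruct (Pz_top E W 0) as (low & ([|c l] & Hll & Hl) & HP); [|discriminate].
      exists (fun z => - alpha W 0 * low1 z); split; [now apply deg_lt_scal|].
      intros z; rewrite HP1, HP, Hl; unfold bet, alpha; simpl.
      rewrite brk_1 by trivial; field; trivial.
    - destruct (Pz_top2 E W m H (Hf (S m) ltac:(lia))) as (low & Hl & HP).
      destruct (Pz_top E W (S m)) as (low' & Hl' & HP').
      exists (fun z => z * low z + (- alpha W (S m)) * low1 z
        + (- bet E (qh E ^ S m)) * low' z); split.
      + repeat apply deg_lt_plus; try apply deg_lt_scal; trivial.
        now apply deg_lt_mulX.
      + intros z.
        transitivity (z * Pz E W (S m) z - alpha W (S m) * Pz E W (S (S m)) z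
          - bet E (qh E ^ S m) * Pz E W (S m) z); [ring|].
        rewrite HP' at 2; rewrite HP1, HP.
        replace (qh E ^ m * qh E) with (qh E ^ S m) by (simpl; ring).
        unfold bet; replace (qh E ^ S m / qh E) with (qh E ^ m) by (simpl; field; auto).
        unfold alpha; simpl; field; trivial. }
  destruct Hdn as (G & HG & HE).
  apply deg_lt_ext with (fun z => G z + (- gam W n) * Pz E W (pred n) z).
  + intros z; unfold F; rewrite <- HE; ring.
  + apply deg_lt_plus; trivial; destruct n as [|m].
    * apply deg_lt_ext with (fun _ => 0); [intros z; simpl; ring | apply deg_lt_zero].
    * apply deg_lt_scal, Pz_deg_lt.
- intros k Hk.
  (* The factor z is moved onto P_k. For k + 1 < n the product z P_k has degree below n. For k + 1 =
     n it is alpha_k P_n plus lower terms, and alpha_k d_n^2 = gamma_n d_k^2. *)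
  assert (Hzk : exists c, pair E W (fun z => Pz E W n z * (z * Pz E W k z)) c /\
    c = if Nat.eqb (S k) n then gam W n * dnorm W k ^ 2 else 0).
  { destruct (Nat.eqb_spec (S k) n) as [Hkn|Hkn].
    - subst n; assert (Hk' := lead_neq0 E W H k (Hf k ltac:(lia))).
      destruct (Pz_top E W k) as (l1 & Hl & HPk).
      destruct (Pz_top E W (S k)) as (l2 & Hl2 & HPSk).
      assert (Hp := pair_Pz_deg_lt E W (S k) (S k)
        (fun z => z * l1 z + (- alpha W k) * l2 z) H (Hf (S k) ltac:(lia))
        (Nat.le_refl _) (deg_lt_plus _ _ _ (deg_lt_mulX _ _ Hl)
          (deg_lt_scal _ _ _ Hl2))).
      assert (Hp' := pair_lin _ _ (alpha W k) 1 _ _ _ _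
        (pair_Pz_eq E W (S k) H (Hf (S k) ltac:(lia))) Hp).
      eexists; split.
      + refine (pair_ext _ _ _ _ _ _ Hp').
        intros z; rewrite (HPk z); rewrite HPSk at 2.
        rewrite Cmult_plus_distr_l; unfold alpha; simpl.
        field_simplify_eq; [|trivial]; rewrite HPSk; simpl; ring.
      + simpl; unfold gammaS, alpha.
        assert (Hdk := dnorm_neq0 E W H k (Hf k ltac:(lia))); field; auto.
    - exists 0; split; trivial.
      apply (pair_Pz_deg_lt E W n (S (S k))); trivial; [apply Hf; lia | lia |].
      apply deg_lt_mulX, Pz_deg_lt. }
  destruct Hzk as (c & Hc & Hce).
  assert (Hpr : pair E W (fun z => Pz E W k z * (gam W n * Pz E W (pred n) z)) c).
  { destruct n as [|m]; [lia|]; simpl pred.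
    assert (Hpk := pair_Pz E W k m H (Hf k ltac:(lia)) (Hf m ltac:(lia))).
    assert (Hp := pair_lin _ _ (gam W (S m)) 0 _ _ _ _ Hpk Hpk).
    rewrite Hce; revert Hp; simpl (Nat.eqb (S k) (S m)).
    destruct (Nat.eqb k m); intros Hp.
    - refine (eq_ind _ (pair E W _) (pair_ext _ _ _ _ _ _ Hp) _ _); [intros z|]; ring.
    - refine (eq_ind _ (pair E W _) (pair_ext _ _ _ _ _ _ Hp) _ _); [intros z|]; ring. }
  assert (Hs1 := pair_Pz_neq E W k (S n) H (Hf k ltac:(lia)) Hn ltac:(lia)).
  assert (Hs2 := pair_Pz_neq E W k n H (Hf k ltac:(lia)) (Hf n ltac:(lia)) ltac:(lia)).
  assert (Hp := pair_lin _ _ 1 1 _ _ _ _ (pair_lin _ _ 1 (-(1)) _ _ _ _ Hc Hpr)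
    (pair_lin _ _ (- alpha W n) (- bet E (qh E ^ n)) _ _ _ _ Hs1 Hs2)).
  refine (eq_ind _ (pair E W _) (pair_ext _ _ _ _ _ _ Hp) _ _); [intros z; unfold F|]; ring.
Qed.

(* The matrix element of [Drel_mulX2] between F0 and itself, for F0 = P_n, F1 = P_(n+1) and
   G = P_(n-1). *)
Lemma diagonal_element (E : equation) (W : system) (F1 F0 G : C -> C)
  (al b ga l1 l0 lm d1 d0 dm : C) :
  standing E W -> in_family (supp W) 0 ->
  ispoly F1 -> ispoly F0 -> ispoly G ->
  Drel E F1 (fun z => - l1 * F1 z) -> Drel E F0 (fun z => - l0 * F0 z) ->
  Drel E G (fun z => - lm * G z) ->
  (forall z, z * F0 z = al * F1 z + (b * F0 z + ga * G z)) ->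
  pair E W (fun z => F1 z * F1 z) d1 -> pair E W (fun z => F0 z * F0 z) d0 ->
  pair E W (fun z => G z * G z) dm -> pair E W (fun z => F1 z * F0 z) 0 ->
  pair E W (fun z => ga * (F1 z * G z)) 0 -> pair E W (fun z => ga * (F0 z * G z)) 0 ->
  (bq E * l1 - 2 * l0 - r2 E) * (al ^ 2 * d1)
  + (bq E * lm - 2 * l0 - r2 E) * (ga ^ 2 * dm)
  = (r0 E + r1 E * b - Kq E * l0 - ((bq E - 2) * l0 - r2 E) * b ^ 2) * d0.
Proof.
intros H Hf P1 P0 PG D1 D0 DG Hz p11 p00 pmm p10 p1m p0m.
assert (Hq := standing_qparam E W H).
set (N := fun z => al * (- l1 * F1 z) + 1 * (b * (- l0 * F0 z) + ga * (- lm * G z))).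
assert (DN : Drel E (fun z => z * F0 z) N).
{ apply Drel_ext with (3 := Drel_lin E al 1 _ _ _ _ Hq D1
    (Drel_lin E b ga _ _ _ _ Hq D0 DG)); intros z; [rewrite Hz; ring | reflexivity]. }
assert (D2 := Drel_mulX2 E _ _ _ Hq D0 DN).
assert (Hsq : ispoly (fun z => z ^ 2)) by (exists 3%nat; apply deg_lt_pow).
cbv beta in D2.
assert (P2 : ispoly (fun z => z ^ 2 * F0 z)) by ispoly_tac.
assert (PD0 : ispoly (fun z => - l0 * F0 z)) by ispoly_tac.
assert (PD2 : ispoly (fun z => bq E * z * N z - z ^ 2 * (- l0 * F0 z)
  + Kq E * (- l0 * F0 z) + Rq E z * F0 z)) by (unfold N, Rq; ispoly_tac).
assert (Hsa := selfadjoint E W _ _ _ _ H Hf P0 PD0 P2 PD2 D0 D2).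
(* The coefficient of (z F0)^2: l0 comes from each of the two terms containing D F0, and r2 from
   R. *)
set (k := 2 * l0 + r2 E).
assert (Hp := pair_lin _ _ 1 1 _ _ _ _
  (pair_lin _ _ ((k - bq E * l1) * al ^ 2)
     ((k - bq E * l0) * b ^ 2 + r1 E * b + r0 E - Kq E * l0) _ _ _ _ p11 p00)
  (pair_lin _ _ 1 1 _ _ _ _
    (pair_lin _ _ ((k - bq E * lm) * ga ^ 2)
      ((2 * k - bq E * l0 - bq E * l1) * al * b + r1 E * al) _ _ _ _ pmm p10)
    (pair_lin _ _ ((2 * k - bq E * l1 - bq E * lm) * al)
      ((2 * k - bq E * l0 - bq E * lm) * b + r1 E) _ _ _ _ p1m p0m))).
apply (pair_ext E W _ (fun z => F0 z * (bq E * z * N z - z ^ 2 * (- l0 * F0 z)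
  + Kq E * (- l0 * F0 z) + Rq E z * F0 z) - z ^ 2 * F0 z * (- l0 * F0 z))) in Hp.
- assert (Hu := total_unique _ _ _ _ Hp Hsa).
  apply Ceq_minus; transitivity (- (1) * 0); [rewrite <- Hu; unfold k|]; ring.
- intros z; unfold Rq.
  transitivity (- bq E * (z * F0 z) * (al * l1 * F1 z + b * l0 * F0 z + ga * lm * G z)
    + k * (z * F0 z) ^ 2 - Kq E * l0 * F0 z ^ 2 + r1 E * (z * F0 z) * F0 z
    + r0 E * F0 z ^ 2); [rewrite Hz | unfold N, k]; ring.
Qed.

(** * The explicit constant and its telescoping *)

Lemma hconst_step (E : equation) (M : C) : qparam E -> M <> 0 ->
  tp E M <> 0 -> tp E (M / qh E) <> 0 ->
  let lam M := brk E M * Lam E M in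
  (qh E + / qh E) * (hconst E M - hconst E (M / qh E))
  = Lam E (M ^ 2) * (r0 E + r1 E * bet E M - Kq E * lam M
                     - ((bq E - 2) * lam M - r2 E) * bet E M ^ 2).
Proof.
intros Hq HM Ht Ht1 lam; unfold lam.
assert (H3 := qh_sq_sub1 E Hq); assert (H2 := qh_sq_add1 E Hq).
assert (H0 := qh_neq0 E).
apply tp_neq0 in Ht; trivial; apply tp_neq0 in Ht1; [|now apply Cdiv_neq0].
assert (Ht2 : g1 E * M ^ 2 * M ^ 2 + g2 E * qh E ^ 4 <> 0).
{ intros Z; apply Ht1.
  transitivity ((g1 E * M ^ 2 * M ^ 2 + g2 E * qh E ^ 4) / qh E ^ 4);
    [field; auto | rewrite Z; unfold Cdiv; ring]. }
assert (H33 := Cmult_neq_0 _ _ H3 H3).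
(* The original coefficients are eliminated in favour of g1, g2, e1, e2, e0, which [field] can then
   treat as independent symbols. *)
assert (HT : ttilde1 E = g1 E + g2 E) by (unfold g1, g2; field; now apply kq_neq0).
assert (HA : stilde2 E / 2 = kq E * (g1 E - g2 E) / 2)
  by (unfold g1, g2; field; now apply kq_neq0).
assert (HU : tt0 E = e1 E + e2 E) by (unfold e1, e2; field; now apply kq_neq0).
assert (HB : st1 E = kq E * (e1 E - e2 E) / 2)
  by (unfold e1, e2; field; now apply kq_neq0).
assert (HC : st0 E = e0 E - kq E * (g1 E - g2 E) * c1 E * c2 E) by (unfold e0; ring).
unfold hconst, r0, r1, r2, Kq; rewrite HT, HA, HU, HB, HC.
unfold bet, off, tp, brk, Lam, bq, kq.
field; nonzero.
Qed.

(** The start n = 0 is separate because [hconst_step] at M = 1 would require tau' at index -1 to be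
    nonzero, which is not assumed. *)
Lemma hconst_1 (E : equation) : qparam E -> tp E 1 <> 0 ->
  let lam M := brk E M * Lam E M in
  (qh E + / qh E) * hconst E 1
  = Lam E (1 ^ 2) * (r0 E + r1 E * bet E 1 - Kq E * lam 1
                     - ((bq E - 2) * lam 1 - r2 E) * bet E 1 ^ 2).
Proof.
intros Hq Ht lam; unfold lam.
assert (H3 := qh_sq_sub1 E Hq); assert (H0 := qh_neq0 E).
assert (Ht1 : g1 E + g2 E <> 0).
{ intros Z; apply Ht; transitivity (g1 E + g2 E); trivial.
  unfold tp; field; apply RtoC_neq0; lra. }
unfold bet; rewrite brk_1, !Cmult_0_l by trivial.
assert (HT : ttilde1 E = g1 E + g2 E) by (unfold g1, g2; field; now apply kq_neq0).
assert (HA : stilde2 E / 2 = kq E * (g1 E - g2 E) / 2)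
  by (unfold g1, g2; field; now apply kq_neq0).
assert (HU : tt0 E = e1 E + e2 E) by (unfold e1, e2; field; now apply kq_neq0).
assert (HB : st1 E = kq E * (e1 E - e2 E) / 2)
  by (unfold e1, e2; field; now apply kq_neq0).
assert (HC : st0 E = e0 E - kq E * (g1 E - g2 E) * c1 E * c2 E) by (unfold e0; ring).
unfold hconst, r0, r1, r2, Kq; rewrite HT, HA, HU, HB, HC.
assert (H1 : RtoC 1 <> 0) by (apply RtoC_neq0; lra).
unfold off, tp, brk, Lam, bq, kq.
field; nonzero.
Qed.

(** At M = q^(n/2) the weight of alpha_n gamma_(n+1) in the diagonal element collapses to a multiple
    of lambda_(2n+2) / [2n+2]_q. In [diag_coef_pred] the other weight becomes the opposite multiple
    at index 2n - 2. This is why one further factor lambda_(2n) / [2n]_q makes the relation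
    telescope. *)
Lemma diag_coef_succ (E : equation) (M : C) : qparam E -> M <> 0 ->
  bq E * (brk E (M * qh E) * Lam E (M * qh E)) - 2 * (brk E M * Lam E M) - r2 E
  = (qh E + / qh E) * Lam E (M ^ 2 * qh E ^ 2).
Proof.
intros Hq HM; assert (H3 := qh_sq_sub1 E Hq); assert (H0 := qh_neq0 E).
unfold brk, Lam, bq, r2, g1, g2, kq, bq; field; nonzero.
Qed.

Lemma diag_coef_pred (E : equation) (M : C) : qparam E -> M <> 0 ->
  bq E * (brk E (M / qh E) * Lam E (M / qh E)) - 2 * (brk E M * Lam E M) - r2 E
  = - (qh E + / qh E) * Lam E (M ^ 2 / qh E ^ 2).
Proof.
intros Hq HM; assert (H3 := qh_sq_sub1 E Hq); assert (H0 := qh_neq0 E).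
unfold brk, Lam, bq, r2, g1, g2, kq, bq; field; nonzero.
Qed.

Lemma gamma_recursion (E : equation) (W : system) (n : nat) :
  standing E W -> in_family (supp W) (S n) ->
  let M := qh E ^ n in let lam M := brk E M * Lam E M in
  let gm := match n return C with O => 0 | S m => alpha W m * gammaS W m end in
  (qh E + / qh E) * (Lam E (M ^ 2 * qh E ^ 2) * (alpha W n * gammaS W n)
                     - Lam E (M ^ 2 / qh E ^ 2) * gm)
  = r0 E + r1 E * bet E M - Kq E * lam M
    - ((bq E - 2) * lam M - r2 E) * bet E M ^ 2.
Proof.
intros H Hn M lam gm; assert (Hq := standing_qparam E W H).
assert (Hf : forall k, (k <= S n)%nat -> in_family (supp W) k)
  by (intros k Hk; now apply in_family_le with (S n)).
assert (HM : M <> 0) by apply qhn_neq0; assert (H0 := qh_neq0 E).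
assert (Hd1 := dnorm_neq0 E W H (S n) Hn).
assert (Hd0 := dnorm_neq0 E W H n (Hf n ltac:(lia))).
assert (Hdm := dnorm_neq0 E W H (pred n) (Hf (pred n) ltac:(lia))).
assert (Ha1 := lead_neq0 E W H (S n) Hn).
assert (Ha0 := lead_neq0 E W H n (Hf n ltac:(lia))).
assert (Hpoly : forall m, ispoly (Pz E W m)) by (intros m; exists (S m); apply Pz_deg_lt).
assert (Hzero : forall F l, pair E W F l -> pair E W (fun z => 0 * F z) 0).
{ intros F l HF; assert (HF' := pair_lin _ _ 0 0 _ _ _ _ HF HF).
  refine (eq_ind _ (pair E W _) (pair_ext _ _ _ _ _ _ HF') _ _); [intros z|]; ring. }
assert (Hort : forall k l, (k <= S n)%nat -> (l < k)%nat ->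
  pair E W (fun z => Pz E W k z * Pz E W l z) 0).
{ intros k l Hk Hl; apply pair_Pz_neq; trivial; try apply Hf; lia. }
assert (Hscal : forall c F, pair E W F 0 -> pair E W (fun z => c * F z) 0).
{ intros c F HF; assert (HF' := pair_lin _ _ c 0 _ _ _ _ HF HF).
  refine (eq_ind _ (pair E W _) (pair_ext _ _ _ _ _ _ HF') _ _); [intros z|]; ring. }
assert (H1m : pair E W (fun z => gam W n * (Pz E W (S n) z * Pz E W (pred n) z)) 0)
  by (apply Hscal, Hort; lia).
(* For n = 0 the third polynomial is P_0 itself, since [pred 0] is 0, and only the coefficient
   [gam W 0], which is 0, makes this pairing vanish. *)
assert (H0m : pair E W (fun z => gam W n * (Pz E W n z * Pz E W (pred n) z)) 0).
{ destruct n as [|m]; [|apply Hscal, Hort; lia].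
  exact (Hzero _ _ (pair_Pz_eq E W 0 H (Hf 0%nat ltac:(lia)))). }
assert (Hdiag := diagonal_element E W _ _ _ _ _ _ _ _ _ _ _ _ H (Hf 0%nat ltac:(lia))
  (Hpoly (S n)) (Hpoly n) (Hpoly (pred n))
  (Drel_Pz E W (S n) H Hn) (Drel_Pz E W n H (Hf n ltac:(lia)))
  (Drel_Pz E W (pred n) H (Hf (pred n) ltac:(lia)))
  (recurrence E W n H Hn)
  (pair_Pz_eq E W (S n) H Hn) (pair_Pz_eq E W n H (Hf n ltac:(lia)))
  (pair_Pz_eq E W (pred n) H (Hf (pred n) ltac:(lia)))
  (Hort (S n) n ltac:(lia) ltac:(lia)) H1m H0m).
rewrite !lambdaE in Hdiag by trivial.
replace (qh E ^ S n) with (M * qh E) in Hdiag by (unfold M; simpl; ring).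
fold M in Hdiag; rewrite diag_coef_succ in Hdiag by trivial.
assert (Hg : gm = gam W n ^ 2 * dnorm W (pred n) ^ 2 / dnorm W n ^ 2).
{ unfold gm; destruct n as [|m]; simpl gam; [unfold Cdiv; ring|].
  unfold alpha, gammaS; simpl pred in *; field; auto. }
(* For n = 0 the index [pred n] is not n - 1 and [diag_coef_pred] does not apply to the left side,
   but both sides contain [gam W 0] and vanish. *)
assert (Hc : (bq E * (brk E (qh E ^ pred n) * Lam E (qh E ^ pred n))
    - 2 * (brk E M * Lam E M) - r2 E) * (gam W n ^ 2 * dnorm W (pred n) ^ 2)
  = - (qh E + / qh E) * Lam E (M ^ 2 / qh E ^ 2) * gm * dnorm W n ^ 2).
{ rewrite Hg, <- diag_coef_pred by trivial.
  destruct n as [|m].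
  - simpl gam; unfold Cdiv; ring.
  - replace (M / qh E) with (qh E ^ pred (S m)) by (unfold M; simpl; field; auto).
    field; auto. }
rewrite Hc in Hdiag; clear Hc.
transitivity ((r0 E + r1 E * bet E M - Kq E * lam M
    - ((bq E - 2) * lam M - r2 E) * bet E M ^ 2) * dnorm W n ^ 2 / dnorm W n ^ 2);
  [|field; trivial].
unfold lam; rewrite <- Hdiag; unfold alpha, gammaS; field; auto.
Qed.

Lemma hmp_hconst (E : equation) (W : system) (n : nat) :
  standing E W -> in_family (supp W) (S n) -> hmp E W n = hconst E (qh E ^ n).
Proof.
intros H; assert (Hq := standing_qparam E W H); assert (H0 := qh_neq0 E).
(* The common factor of both relations is (q + 1) / q^(1/2), nonzero because q > 0. It is the only
   quantity cancelled, so values lambda_(2n) = 0 do no harm. *)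
assert (Hp : qh E + / qh E <> 0).
{ replace (qh E + / qh E) with ((qh E ^ 2 + 1) / qh E) by (field; auto).
  apply Cdiv_neq0; trivial; now apply qh_sq_add1. }
assert (Hmp : forall m, hmp E W m = Lam E ((qh E ^ m) ^ 2)
  * Lam E ((qh E ^ m) ^ 2 * qh E ^ 2) * (alpha W m * gammaS W m)).
{ intros m; unfold hmp; rewrite !lambda_overE, Cpow_add_r, !qh_double by trivial; ring. }
assert (Htp : forall m k, in_family (supp W) k -> (m <= k)%nat -> tp E (qh E ^ m) <> 0).
{ intros m k Hk Hm; rewrite <- tau_n'E by trivial.
  apply (tau_n'_neq0 E W H), (in_family_le _ m k Hm Hk). }
induction n as [|n IH]; intros Hn;
  assert (Hg := gamma_recursion E W _ H Hn); cbv beta zeta iota in Hg.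
- assert (Ht := Htp 0%nat 1%nat Hn ltac:(lia)); simpl (qh E ^ 0) in *.
  assert (H1 := hconst_1 E Hq Ht); cbv beta zeta in H1.
  rewrite <- Hg in H1; rewrite Hmp; simpl (qh E ^ 0).
  set (k := qh E + / qh E) in *.
  transitivity (k * hconst E 1 / k); [|field; trivial].
  rewrite H1; field; trivial.
- assert (Ht := Htp (S n) (S (S n)) Hn ltac:(lia)).
  assert (Ht' := Htp n (S (S n)) Hn ltac:(lia)).
  assert (HM := qhn_neq0 E (S n)).
  assert (HMn : qh E ^ S n / qh E = qh E ^ n) by (simpl; field; auto).
  rewrite <- HMn in Ht'.
  assert (Hs := hconst_step E (qh E ^ S n) Hq HM Ht Ht'); cbv beta zeta in Hs.
  rewrite <- Hg in Hs; rewrite HMn in Hs.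
  rewrite <- IH, Hmp in Hs by (apply in_family_le with (S (S n)); [lia | trivial]).
  rewrite Hmp.
  replace (Lam E ((qh E ^ n) ^ 2 * qh E ^ 2)) with (Lam E ((qh E ^ S n) ^ 2)) in Hs
    by (f_equal; simpl; ring).
  replace (Lam E ((qh E ^ n) ^ 2)) with (Lam E ((qh E ^ S n) ^ 2 / qh E ^ 2)) in Hs
    by (f_equal; simpl; field; auto).
  apply Ceq_minus.
  transitivity ((- ((qh E + / qh E) * (hconst E (qh E ^ S n)
    - Lam E ((qh E ^ S n) ^ 2 / qh E ^ 2) * Lam E ((qh E ^ S n) ^ 2)
      * (alpha W n * gammaS W n)))
    + Lam E ((qh E ^ S n) ^ 2) * ((qh E + / qh E)
      * (Lam E ((qh E ^ S n) ^ 2 * qh E ^ 2) * (alpha W (S n) * gammaS W (S n))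
         - Lam E ((qh E ^ S n) ^ 2 / qh E ^ 2) * (alpha W n * gammaS W n))))
    / (qh E + / qh E)).
  + set (k := qh E + / qh E) in *; field; trivial.
  + rewrite Hs; unfold Cdiv; ring.
Qed.

Theorem theorem4p1 (E : equation) (W : system) (hyp : standing E W) :
  (forall n : nat, in_family (supp W) n ->
     forall s : C, H_regular E W s -> Hop E W n (phi E W n) s = 0) /\
  (forall n : nat, in_family (supp W) (S n) ->
     op_eq_on (regular_mp E W n)
       (op_mul (fun s => u E (s + 1) n) (Hop E W n))
       (op_sub (op_comp (Lminus E W (S n)) (Lplus E W n))
               (op_mul (fun _ => hmp E W n) Iop)) /\
     op_eq_on (regular_pm E W n)
       (op_mul (fun s => u E s n) (Hop E W (S n)))
       (op_sub (op_comp (Lplus E W n) (Lminus E W (S n)))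
               (op_mul (fun _ => hmp E W n) Iop))).
Proof.
split.
- intros n Hn s Hs; now apply Hop_phi.
- intros n Hn; assert (Hh := hmp_hconst E W n hyp Hn).
  split; [now apply factorization_mp | now apply factorization_pm].
Qed.
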